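(* Let $G$ be a graph on a linearly ordered set of edges $E$. Then $$t(G;x,y)=\sum\ \Bigl(\prod_{1\le k\le\iota}\beta\bigl(G(F_k)/F_{k-1}\bigr)\Bigr)\Bigl(\prod_{1\le k\le\varepsilon}\beta^*\bigl(G(F'_{k-1})/F'_k\bigr)\Bigr)\,x^\iota y^\varepsilon,$$ where the sum can be equally: (1) either over all connected filtrations $(F'_\varepsilon,\ldots,F'_0,F_c,F_0,\ldots,F_\iota)$ of $G$; (2) or over all filtrations $(F'_\varepsilon,\ldots,F'_0,F_c,F_0,\ldots,F_\iota)$ of $E$. (In both cases $\iota,\varepsilon\ge0$ vary with the filtration.)
   Context: Graphs are finite, may have loops and multiple edges, and are connected unless they arise as minors (isolated vertices are ignored, and for a disconnected graph ''spanning tree'' means maximal spanning forest). For $F\subseteq E$, $G(F)$ is the restriction of $G$ to the edges in $F$ (deletion of $E\setminus F$) and $G/F$ is the contraction of $F$. Minors inherit the order. $\subset$ denotes strict inclusion. $t(G;x,y)$ is the Tutte polynomial of $G$: $t(G;x,y)=\sum_{\iota,\varepsilon}t_{\iota,\varepsilon}x^\iota y^\varepsilon$, where $t_{\iota,\varepsilon}$ is the number of spanning trees with internal activity $\iota$ and external activity $\varepsilon$ (for a spanning tree $T$, the internal activity is the number of $b\in T$ that are smallest in their fundamental cocycle w.r.t. $T$, the external activity is the number of $e\notin T$ that are smallest in their fundamental cycle w.r.t. $T$). $\beta(H)=t_{1,0}(H)$ is the beta invariant of the graph $H$ (so $\beta=1$ for a single isthmus and $\beta=0$ for a single loop). $\beta^*(H)=\beta(H)$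 if $H$ has at least two edges, $\beta^*=1$ for a graph consisting of a single loop, $\beta^*=0$ for a graph consisting of a single isthmus. A filtration of $G$ (or of $E$) is a sequence $(F'_\varepsilon,\ldots,F'_0,F_c,F_0,\ldots,F_\iota)$ of subsets of $E$ with $\emptyset=F'_\varepsilon\subset\cdots\subset F'_0=F_c=F_0\subset\cdots\subset F_\iota=E$, such that $\min(F_k\setminus F_{k-1})$, $1\le k\le\iota$, is increasing with $k$ and $\min(F'_{k-1}\setminus F'_k)$, $1\le k\le\varepsilon$, is increasing with $k$. It is connected if for every $1\le k\le\iota$ the minor $G(F_k)/F_{k-1}$ is either loopless and 2-connected with at least two edges, or a single isthmus, and for every $1\le k\le\varepsilon$ the minor $G(F'_{k-1})/F'_k$ is either loopless and 2-connected with at least two edges, or a single loop. (2-connected means 2-vertex-connected; a loopless graph on two vertices with at least one edge counts as 2-connected.) *)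

(* Defs.v *)
From HB Require Import structures.
From mathcomp Require Import all_boot all_order all_algebra.

Set Implicit Arguments.
Unset Strict Implicit.
Unset Printing Implicit Defensive.

Import Order.TTheory GRing.Theory.

(* Multigraphs with loops.  A minor keeps the ambient types V and E and only
   changes [edges] and [ends], so it inherits the order of E; [ends e] is
   meaningful only for [e \in edges G].  The orientation of [ends] is
   irrelevant.  Vertices of V incident to no edge are isolated; they are not
   counted as vertices of the graph (see [vset]). *)
Record graph (V E : finType) :=
  Graph { edges : {set E}; ends : E -> V * V }.

Section Graphs.
Variables V E : finType.
Implicit Types (G H : graph V E) (F T C D : {set E}) (X : {set V}) (e b : E).

Definition is_loop G e := (ends G e).1 == (ends G e).2.

Definition loopless G := [forall e in edges G, ~~ is_loop G e].

Definition vset G : {set V} :=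
  [set v | [exists e in edges G, (v == (ends G e).1) || (v == (ends G e).2)]].

Definition adj G F : rel V := fun u v =>
  [exists e in F, (ends G e == (u, v)) || (ends G e == (v, u))].

(* The vertices in X are joined pairwise by paths of G staying inside X. *)
Definition connected_on G X :=
  [forall u in X, forall v in X,
     connect (fun x y => [&& x \in X, y \in X & adj G (edges G) x y]) u v].

Definition connected_graph G := connected_on G (vset G).

(* The removal of v may isolate vertices of G, and these do count here. *)
Definition two_connected G :=
  [&& 1 < #|vset G|, connected_graph G
    & [forall v in vset G, connected_on G (vset G :\ v)]].

Definition isthmus G e :=
  (e \in edges G) &&
  ~~ connect (adj G (edges G :\ e)) (ends G e).1 (ends G e).2.

Definition single_isthmus G := [exists e, (edges G == [set e]) && isthmus G e].

Definition single_loop G := [exists e, (edges G == [set e]) && is_loop G e].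

(* G(F) *)
Definition restrict G F : graph V E := Graph (edges G :&: F) (ends G).

(* G/F: each vertex is replaced by a fixed representative of its connected
   component in F, so the other vertices of the component become isolated. *)
Definition contract G F : graph V E :=
  let r := fingraph.root (adj G (edges G :&: F)) in
  Graph (edges G :\: F) (fun e => (r (ends G e).1, r (ends G e).2)).

(* G(F)/F' *)
Definition minor G F F' : graph V E := contract (restrict G F) F'.

(* An edge together with a direction of traversal. *)
Definition dart := (E * bool)%type.
Definition dsrc G (a : dart) : V :=
  if a.2 then (ends G a.1).1 else (ends G a.1).2.
Definition dtgt G (a : dart) : V :=
  if a.2 then (ends G a.1).2 else (ends G a.1).1.

(* C is the edge set of a closed walk with no repeated edge and no repeated
   vertex; a loop is a cycle of length 1, two parallel edges form a cycle of
   length 2.  Since edges are not repeated, the length is at most #|E|. *)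
Definition is_cycle G C :=
  (C \subset edges G) &&
  [exists n : 'I_#|E|.+1, exists s : n.-tuple dart,
     [&& 0 < n, cycle (fun a1 a2 : dart => dtgt G a1 == dsrc G a2) s,
         uniq (map (dsrc G) s), uniq (map fst s)
       & C == [set e in map fst s]]].

Definition cut G X : {set E} :=
  [set e in edges G | ((ends G e).1 \in X) (+) ((ends G e).2 \in X)].

Definition nonempty_cut G D := (D != set0) && [exists X, D == cut G X].

Definition is_cocycle G D := minset (nonempty_cut G) D.

Definition forest G F :=
  (F \subset edges G) && [forall C, is_cycle G C ==> ~~ (C \subset F)].

Definition spanning_tree G T := maxset (forest G) T.

(* When T is a spanning tree and e \in edges G :\: T (resp. b \in T), there is
   exactly one such C (resp. D). *)
Definition fundamental_cycle G T e C := is_cycle G C && (C \subset e |: T).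

Definition fundamental_cocycle G T b D :=
  is_cocycle G D && (D \subset b |: (edges G :\: T)).

End Graphs.

Section Activities.
Variables (d : Order.disp_t) (V : finType) (E : finOrderType d).
Implicit Types (G H : graph V E) (T A : {set E}).

Definition is_min (e : E) A := (e \in A) && [forall f in A, (e <= f)%O].

Definition internal_activity G T :=
  #|[set b in T | [exists D, fundamental_cocycle G T b D && is_min b D]]|.

Definition external_activity G T :=
  #|[set e in edges G :\: T |
       [exists C, fundamental_cycle G T e C && is_min e C]]|.

Definition tcoef G (i j : nat) : nat :=
  #|[set T | [&& spanning_tree G T, internal_activity G T == i
               & external_activity G T == j]]|.

(* x is 'X and y is 'Y; activities are at most #|E|. *)
Definition tutte G : {poly {poly int}} :=
  (\sum_(i < #|E|.+1) \sum_(j < #|E|.+1)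
     (tcoef G i j)%:R * ('X ^+ i * 'Y ^+ j))%R.

Definition beta G : nat := tcoef G 1 0.

Definition beta_star G : nat :=
  if 1 < #|edges G| then beta G else single_loop G.

(* A filtration (F'_epsilon, ..., F'_0, Fc, F_0, ..., F_iota) is given by
   F' = [:: F'_0; ...; F'_epsilon], Fc and F = [:: F_0; ...; F_iota]. *)
Local Notation "s @ k" := (nth (@set0 E) s k) (at level 9).

Definition is_filtration G (F' : seq {set E}) (Fc : {set E})
    (F : seq {set E}) : bool :=
  let iota := (size F).-1 in let epsilon := (size F').-1 in
  [&& 0 < size F, 0 < size F',
      F'@epsilon == set0, F'@0 == Fc, Fc == F@0, F@iota == edges G,
      [forall k : 'I_iota, F@k \proper F@(k.+1)],
      [forall k : 'I_epsilon, F'@(k.+1) \proper F'@k],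
      [forall k : 'I_iota, forall l : 'I_iota, (k < l) ==>
         [exists a, exists b, [&& is_min a (F@(k.+1) :\: F@k),
            is_min b (F@(l.+1) :\: F@l) & (a < b)%O]]]
    & [forall k : 'I_epsilon, forall l : 'I_epsilon, (k < l) ==>
         [exists a, exists b, [&& is_min a (F'@k :\: F'@(k.+1)),
            is_min b (F'@l :\: F'@(l.+1)) & (a < b)%O]]]].

Definition big_block H := [&& loopless H, two_connected H & 1 < #|edges H|].

Definition is_connected_filtration G (F' : seq {set E}) (Fc : {set E})
    (F : seq {set E}) : bool :=
  let iota := (size F).-1 in let epsilon := (size F').-1 in
  [&& is_filtration G F' Fc F,
      [forall k : 'I_iota, let H := minor G (F@(k.+1)) (F@k) in
         big_block H || single_isthmus H]
    & [forall k : 'I_epsilon, let H := minor G (F'@k) (F'@(k.+1)) in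
         big_block H || single_loop H]].

(* The sum of (prod beta) (prod beta_star) x^iota y^epsilon over the filtrations
   satisfying P.  The inclusions being strict, iota and epsilon are at most
   #|E|, so the bounds on the first two indices exclude no filtration. *)
Definition filtration_sum G
    (P : seq {set E} -> {set E} -> seq {set E} -> bool) : {poly {poly int}} :=
  (\sum_(iota < #|E|.+1) \sum_(epsilon < #|E|.+1)
     \sum_(F' : epsilon.+1.-tuple {set E}) \sum_(Fc : {set E})
     \sum_(F : iota.+1.-tuple {set E} | P F' Fc F)
        (\prod_(1 <= k < iota.+1) beta (minor G (F@k) (F@(k.-1))))%N%:R
      * (\prod_(1 <= k < epsilon.+1)
           beta_star (minor G (F'@(k.-1)) (F'@k)))%N%:R
      * ('X ^+ iota * 'Y ^+ epsilon))%R.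

End Activities.

(* Main.v *)
Require Import Defs.
From mathcomp Require Import all_boot all_order all_algebra.

(** Fix a spanning tree T of G.  Its fundamental graph is the bipartite graph
    that joins b in T to e outside T when b lies on the fundamental cycle of e,
    that is, when T minus b no longer connects the ends of e.  An edge is active
    if and only if it is smaller than all its neighbours in this graph, so the
    activities of T depend on an ordered bipartite graph only.  Moreover T
    induces spanning trees of G(F) and of G/F if and only if no e in F has a
    neighbour b in T outside F ([basis_stable]), and the fundamental graph in
    a minor G(F2)/F1 is then the subgraph induced on F2 minus F1
    ([fund_adj_minor]).

    The heart of the proof is a statement on ordered bipartite graphs: there is
    exactly one filtration whose sets are closed in the above sense and whose
    successive differences induce subgraphs with one active element each, lying
    in T for the upper parts (those of F) and outside T for the lower ones
    (those of F').  Indeed each part then has its minimum as its only active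
    element, and these minima are exactly the active elements of the whole
    graph; hence there are as many upper and lower parts as internally and
    externally active edges.  A nonactive x has a smaller neighbour in its own
    part, so closedness forces, for a set S of the filtration: x in T is in S
    if and only if some smaller neighbour is, and x outside T is in S if and
    only if all smaller neighbours are.  Going through E in increasing order, S
    is determined by its active elements ([decomposition_eq]).  Conversely this
    rule, applied to the initial segments of the active elements, produces
    such a filtration ([decomposition_exists]).

    It remains to count the pairs of a tree and its filtration the other way
    round.  For a given filtration, the trees that it decomposes are the unions
    of arbitrary trees of the minors G(F_k)/F_(k-1) of activities (1,0) and of
    the minors G(F'_(k-1))/F'_k of activities (0,1) ([decomposesP],
    [card_decomposes]).  The former are counted by [beta] by definition, the
    latter by [beta_star]: when there are two edges or more, exchanging the two
    smallest edges turns trees of activities (1,0) into trees of activities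
    (0,1) and conversely ([uniactive_swap]).  This gives the sum over all
    filtrations.  Finally, if a minor with two edges or more has a loop, is
    disconnected or has a cut vertex, its edges split into two sets without
    fundamental adjacencies between them; the minimum of each is active, so
    that no tree has only one active edge ([uniactive_big_block]).  Therefore
    only the connected filtrations contribute. *)

Set Implicit Arguments.
Unset Strict Implicit.
Unset Printing Implicit Defensive.

Import Order.POrderTheory Order.TotalTheory GRing.Theory.

(** * Edges spanned by a set of edges, and cycles *)

Section Spans.
Variables V E : finType.
Implicit Types (G H : graph V E) (F T C D A B : {set E}) (X : {set V}) (e f b : E).

(** The closure operator of the graphic matroid.  Trees, fundamental cycles and
    cocycles, minors and activities are all expressed below through it, by
    monotonicity, transitivity ([spans_trans]) and exchange
    ([spans_exchange]). *)
Definition spans G F e := connect (adj G F) (ends G e).1 (ends G e).2.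

Lemma adj_sym G F : connect_sym (adj G F).
Proof.
apply: sym_connect_sym => u v; apply/existsP/existsP => -[e /andP[eF h]];
  by exists e; rewrite eF orbC.
Qed.

Lemma adj_end G F e : e \in F -> adj G F (ends G e).1 (ends G e).2.
Proof.
by move=> eF; apply/existsP; exists e; rewrite eF -surjective_pairing eqxx.
Qed.

Lemma spans_mem G F e : e \in F -> spans G F e.
Proof. by move=> eF; apply/connect1/adj_end. Qed.

Lemma connect_spans G F F' : {in F', forall f, spans G F f} ->
  subrel (connect (adj G F')) (connect (adj G F)).
Proof.
move=> FF'; apply: connect_sub => u v /existsP[f /andP[/FF' + /orP[]/eqP ef]];
  by rewrite /spans ef //= adj_sym.
Qed.

Lemma spans_trans G F F' e :
  {in F', forall f, spans G F f} -> spans G F' e -> spans G F e.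
Proof. by move=> FF'; apply: connect_spans. Qed.

Lemma spansS G F F' e : F' \subset F -> spans G F' e -> spans G F e.
Proof. by move=> /subsetP sub; apply: spans_trans => f /sub; apply: spans_mem. Qed.

(** A path through f can be cut at its first and last passage along f. *)
Lemma connect_setU1 G F f x y (u := (ends G f).1) (v := (ends G f).2)
    (c := connect (adj G F)) :
  connect (adj G (f |: F)) x y -> [\/ c x y, c x u /\ c v y | c x v /\ c u y].
Proof.
case/connectP => p; elim: p x => [x _ -> | z p IHp x /= /andP[xz /IHp{}IHp] /IHp{IHp}].
  by apply: Or31; apply: connect0.
case/existsP: xz => g /andP[/setU1P[-> | gF] eg].
  have {eg} [[-> ->] | [-> ->]] : (x = u /\ z = v) \/ (x = v /\ z = u).
    by case/orP: eg => /eqP; rewrite /u /v => ->; [left | right].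
    by case=> [vy | [_ vy] | [_ uy]]; [apply: Or32 | apply: Or32 | apply: Or31];
      rewrite ?/c ?connect0.
  by case=> [uy | [_ vy] | [_ uy]]; [apply: Or33 | apply: Or31 | apply: Or33];
    rewrite ?/c ?connect0.
have xz : c x z by apply: connect1; apply/existsP; exists g; rewrite gF.
by case=> [zy | [zu vy] | [zv uy]]; [apply: Or31 | apply: Or32;
  split=> // | apply: Or33; split=> //];
  apply: connect_trans xz _.
Qed.

Lemma spans_exchange G F e f :
  spans G (f |: F) e -> ~~ spans G F e -> spans G (e |: F) f.
Proof.
have sub : subrel (connect (adj G F)) (connect (adj G (e |: F))).
  by apply: connect_spans => g gF; apply: spans_mem; rewrite inE gF orbT.
have ee : spans G (e |: F) e by apply: spans_mem; rewrite setU11.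
case/connect_setU1=> [h | [h1 h2] _ | [h1 h2] _]; first by rewrite /spans h.
  rewrite /spans adj_sym; apply: connect_trans (sub _ _ h2) _.
  rewrite adj_sym; apply: connect_trans ee; rewrite adj_sym; exact: sub h1.
apply: connect_trans (sub _ _ h2) _; rewrite adj_sym.
by apply: connect_trans ee; rewrite adj_sym; exact: sub h1.
Qed.

Lemma dart_adj G F (a : dart E) : a.1 \in F -> connect (adj G F) (dsrc G a) (dtgt G a).
Proof.
by case: a => e [] eF; [| rewrite adj_sym]; apply/connect1/adj_end.
Qed.

Lemma walk_connect G F (a : dart E) s :
  path (fun a1 a2 : dart E => dtgt G a1 == dsrc G a2) a s ->
  {in s, forall a, a.1 \in F} ->
  connect (adj G F) (dtgt G a) (dtgt G (last a s)).
Proof.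
elim: s a => [|a' s IHs] a /=; first by rewrite connect0.
case/andP=> /eqP-> /IHs{}IHs sF; apply: connect_trans (dart_adj _ _) (IHs _).
  by apply: sF; rewrite mem_head.
by move=> b bs; apply: sF; rewrite inE bs orbT.
Qed.

Lemma cycle_spans G C f : is_cycle G C -> f \in C -> spans G (C :\ f) f.
Proof.
case/andP=> _ /existsP[n /existsP[s /and5P[_ cyc _ uq /eqP defC]]].
rewrite {1}defC inE => /mapP[a as_ ->].
have [i s' def_s] := rot_to as_.
move: cyc uq; rewrite -(rot_cycle i) -(rot_uniq i) -map_rot def_s /= rcons_path.
case/andP=> pth /eqP lst /andP[notin uq].
have key : connect (adj G (C :\ a.1)) (dtgt G a) (dsrc G a).
  rewrite -lst; apply: walk_connect pth _ => b bs'.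
  rewrite !inE (memPn notin) ?map_f // defC inE map_f //.
  by rewrite -(mem_rot i) def_s inE bs' orbT.
by move: key; rewrite /dtgt /dsrc /spans; case: a.2 => //; rewrite adj_sym.
Qed.

(** An edge occurring twice on a path would bring it back to a vertex already
    visited; hence the darts chosen along a path without repeated vertices have
    distinct edges. *)
Lemma path_darts G F x p : path (adj G F) x p -> uniq (x :: p) ->
  exists s : seq (dart E),
    [/\ map (dsrc G) s = belast x p, map (dtgt G) s = p,
        uniq (map fst s), {in s, forall a, a.1 \in F}
      & forall a, dtgt G a = x ->
          path (fun a1 a2 : dart E => dtgt G a1 == dsrc G a2) a s].
Proof.
elim: p x => [|y p IHp] x; first by exists [::].
move=> /= /andP[xy yp] /andP[xNp uq].
have [s [src tgt us sF ps]] := IHp _ yp uq.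
have [a [aF ax ay]] : exists a : dart E, [/\ a.1 \in F, dsrc G a = x & dtgt G a = y].
  case/existsP: xy => e /andP[eF /orP[]/eqP ee].
    by exists (e, true); rewrite /dsrc /dtgt ee.
  by exists (e, false); rewrite /dsrc /dtgt ee.
exists (a :: s); rewrite !map_cons ax ay src tgt; split=> //=.
- rewrite us andbT; apply: contra xNp => /mapP[b bs ab].
  have : (x == dsrc G b) || (x == dtgt G b).
    by rewrite -ax /dsrc /dtgt ab; case: a.2; case: b.2; rewrite eqxx ?orbT.
  case/orP=> /eqP->.
    by have := map_f (dsrc G) bs; rewrite src => /mem_belast.
  by have := map_f (dtgt G) bs; rewrite tgt inE => ->; rewrite orbT.
- by move=> b; rewrite inE => /predU1P[-> | /sF].
by move=> c cx; rewrite -/(dsrc G a) ax cx eqxx ps.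
Qed.

(** With [cycle_spans], this replaces cycles by the relation [spans] in the
    definition of forests: the cycle is f followed by a path without repeated
    vertices between its ends. *)
Lemma dependent_cycle G F f : F \subset edges G -> f \in F ->
  spans G (F :\ f) f -> exists2 C, is_cycle G C & C \subset F.
Proof.
move=> /subsetP FG fF; rewrite /spans adj_sym => /connectP[p0 pth0 lst0].
case: (shortenP pth0) lst0 => p pth uq _ lst.
have [s [src tgt us sF ps]] := path_darts pth uq.
pose s1 : seq (dart E) := (f, true) :: s.
have us1 : uniq (map fst s1).
  rewrite /= us andbT; apply/negP => /mapP[a /sF +/= fa].
  by rewrite -fa !inE eqxx.
have s1F : {in map fst s1, forall e, e \in F}.
  move=> e; rewrite inE => /predU1P[-> // | /mapP[a /sF + ->]].
  by rewrite inE => /andP[].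
have sz : size s1 < #|E|.+1.
  by rewrite ltnS -(size_map fst) -(card_uniqP us1) max_card.
exists [set e in map fst s1]; last by apply/subsetP=> e; rewrite inE => /s1F.
apply/andP; split; first by apply/subsetP=> e; rewrite inE => /s1F/FG.
apply/existsP; exists (Ordinal sz); apply/existsP; exists (in_tuple s1).
rewrite us1 eqxx andbT /= !andbT rcons_path ps //= src; apply/andP; split.
  apply/eqP; rewrite /dsrc/= lst.
  have {}lst : dtgt G (f,true) = (ends G f).2 by [].
  by rewrite -tgt -lst last_map.
have -> : dsrc G (f, true) = last (ends G f).2 p by rewrite -lst.
by move: uq; rewrite lastI rcons_uniq.
Qed.

End Spans.

(** * Spanning trees, fundamental cycles and fundamental cocycles *)

Section Trees.
Variables V E : finType.
Implicit Types (G H : graph V E) (F T C D A B : {set E}) (X : {set V}) (e f b : E).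

Lemma forestP G F :
  reflect (F \subset edges G /\ {in F, forall e, ~~ spans G (F :\ e) e}) (forest G F).
Proof.
apply: (iffP andP) => [] [FG h]; split=> //.
  move=> e eF; apply/negP => /(dependent_cycle FG eF)[C cC CF].
  by have /forallP/(_ C) := h; rewrite cC CF.
apply/forallP=> C; apply/implyP=> cC; apply/negP=> CF.
have [f fC] : exists f, f \in C.
  case/andP: cC => _ /existsP[n /existsP[s /and5P[n0 _ _ _ /eqP->]]].
  case: s => -[|a s] /= sz; first by rewrite -(eqP sz) in n0.
  by exists a.1; rewrite inE mem_head.
have /negP[] := h f (subsetP CF _ fC).
by apply: spansS (cycle_spans cC fC); apply: setSD.
Qed.

Lemma forestU1 G F e :
  forest G F -> e \in edges G -> ~~ spans G F e -> forest G (e |: F).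
Proof.
move=> /forestP[FG indF] eG eF; have eNF : e \notin F by apply: contra eF; apply: spans_mem.
apply/forestP; split=> [|f]; first by rewrite subUset sub1set eG.
case/setU1P=> [-> | fF]; first by rewrite setU1K.
have fe : e != f by apply: contraNneq eNF => ->.
rewrite setDUl (_ : [set e] :\ f = [set e]); last first.
  by apply/setDidPl; rewrite disjoints1 inE.
by apply: contra eF => /spans_exchange/(_ (indF f fF)); rewrite setD1K.
Qed.

Lemma spanning_treeP G T :
  reflect [/\ T \subset edges G, {in T, forall e, ~~ spans G (T :\ e) e}
            & {in edges G, forall e, spans G T e}] (spanning_tree G T).
Proof.
apply: (iffP maxsetP) => [[fT maxT] | [TG indT spT]].
  have /forestP[TG indT] := fT; split=> // e eG; apply: contraT => eNT.
  have eT := maxT _ (forestU1 fT eG eNT) (subsetUr _ _).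
  by case/negP: eNT; apply: spans_mem; rewrite -eT setU11.
split; first by apply/forestP.
move=> B /forestP[BG indB] TB; apply/eqP; rewrite eqEsubset TB andbT.
apply/subsetP=> e eB; apply: contraT => eT; case/negP: (indB e eB).
by apply: spansS (spT e (subsetP BG e eB)); rewrite subsetD1 TB.
Qed.

Lemma tree_exchange G T b e : spanning_tree G T -> b \in T -> e \in edges G ->
  ~~ spans G (T :\ b) e -> spanning_tree G (e |: (T :\ b)).
Proof.
move=> /spanning_treeP[TG indT spT] bT eG nbe.
have fTb : forest G (T :\ b).
  apply/forestP; split=> [|f]; first by apply: subset_trans TG; apply: subsetDl.
  rewrite inE => /andP[_ /indT]; apply: contra; apply: spansS; apply: setSD;
    apply: subsetDl.
have /forestP[eTG indeT] := forestU1 fTb eG nbe.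
apply/spanning_treeP; split=> // f fG; apply: spans_trans (spT f fG) => g gT.
have [-> | gb] := eqVneq g b; last by apply: spans_mem; rewrite !inE gb gT orbT.
by apply: spans_exchange nbe; rewrite setD1K // spT.
Qed.

(** The sets B of tree edges that span e are closed under intersection, being
    those that contain the fundamental cycle of e minus e. *)
Lemma spansD2 G T b c e : {in T, forall e, ~~ spans G (T :\ e) e} -> b \in T ->
  c \in T -> b != c ->
  spans G (T :\ b) e -> spans G (T :\ c) e -> spans G (T :\ b :\ c) e.
Proof.
move=> indT bT cT bc sb sc; apply: contraT => nbc; case/negP: (indT c cT).
have cTb : c \in T :\ b by rewrite !inE eq_sym bc.
move: sb; rewrite -{1}(setD1K cTb) => /spans_exchange/(_ nbc); apply: spans_trans => f.
case/setU1P=> [-> // | fT]; apply: spans_mem.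
by move: fT; rewrite !inE => /and3P[-> _ ->].
Qed.

(** The tree edges of the fundamental cycle of e suffice to span e: a minimal
    spanning subset of T contains, by exchange, no other edge. *)
Lemma tree_support G T A e :
  {in T, forall b, ~~ spans G (T :\ b) b} -> spans G T e ->
  (forall b, b \in T -> ~~ spans G (T :\ b) e -> b \in A) -> spans G (T :&: A) e.
Proof.
move=> indT sTe TA.
have [B /minsetP[/= sBe minB] BT] := minset_exists (P := fun B => spans G B e) sTe.
apply: (spansS _ sBe); apply/subsetP => b bB; rewrite inE (subsetP BT) //=.
apply: TA; first exact: (subsetP BT).
have nBb : ~~ spans G (B :\ b) e.
  apply/negP=> /minB/(_ (subsetDl _ _)) eB.
  by move: bB; rewrite -eB !inE eqxx.
move: (sBe); rewrite -(setD1K bB) => /spans_exchange/(_ nBb) sb.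
apply: contra (indT b (subsetP BT b bB)) => sTb; apply: spans_trans sb => f.
case/setU1P=> [-> // | fB]; apply: spans_mem.
by move: fB; rewrite !inE => /andP[-> /(subsetP BT)].
Qed.

(** D separates the two components of T minus b, so it consists of the edges
    that T minus b does not span.  Uniqueness holds because a cut disjoint from
    a set of edges contains no edge spanned by it. *)
Lemma fundamental_cocycleP G T b D : spanning_tree G T -> b \in T ->
  reflect (D = [set e in edges G | ~~ spans G (T :\ b) e])
          (fundamental_cocycle G T b D).
Proof.
move=> tT bT; have /spanning_treeP[TG indT spT] := tT.
set D0 := [set e in _ | _].
have cut_spans X F e : [disjoint F & cut G X] -> F \subset edges G -> e \in edges G ->
    spans G F e -> e \notin cut G X.
  move=> dF FG eG; rewrite inE eG /= => /(@closed_connect _ _ [in X])->;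
    first by rewrite addbb.
  move=> u v /existsP[f /andP[fF ef]].
  have := disjointFr dF fF; rewrite inE (subsetP FG) //=.
  by case/orP: ef => /eqP-> /=; do 2!case: (_ \in X).
have sub_ex D' : D' \subset b |: edges G :\: T -> nonempty_cut G D' -> D' = D0.
  move=> sD /andP[neD /existsP[X /eqP DX]].
  have disj F : F \subset T :\ b -> [disjoint F & D'].
    move=> FT; rewrite disjoint_sym; apply/pred0P => f /=; apply: contraTF FT =>
      /andP[/(subsetP sD)].
    rewrite !inE => fF f'; apply/subsetPn; exists f => //; rewrite !inE.
    by case: (f == b) fF => //= /andP[/negbTE->].
  have TbG : T :\ b \subset edges G by apply: subset_trans TG; apply: subsetDl.
  have bD : b \in D'.
    apply: contraNT neD => bD; apply/eqP/setP => e; rewrite [RHS]inE.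
    apply/negbTE; apply/negP=> eD; suff: e \notin D' by rewrite eD.
    have eG : e \in edges G by move: eD; rewrite DX inE => /andP[].
    rewrite DX; apply: (cut_spans _ T); rewrite ?spT // -DX -(setD1K bT).
    by rewrite disjoints_subset subUset sub1set inE bD -disjoints_subset disj.
  apply/setP => e; rewrite inE; have [eG | eG] /= := boolP (e \in edges G); last first.
    by apply: contraNF eG; rewrite DX inE => /andP[].
  apply/idP/idP => [eD | neb].
    apply/negP => seb; suff: e \notin D' by rewrite eD.
    by rewrite DX; apply: (cut_spans _ (T :\ b)); rewrite -?DX ?disj.
  apply: contraT => eD; suff: b \notin D' by rewrite bD.
  rewrite DX.
  apply: (cut_spans _ (e |: (T :\ b))); rewrite -?DX ?(subsetP TG) //.
  - by rewrite disjoints_subset subUset sub1set inE eD -disjoints_subset disj.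
  - by rewrite subUset sub1set eG.
  by apply: spans_exchange neb; rewrite setD1K // spT.
have subD0 : D0 \subset b |: edges G :\: T.
  apply/subsetP=> e; rewrite !inE => /andP[eG neb]; rewrite eG andbT.
  by case: eqP => //= /eqP eb; apply: contra neb => eT; apply: spans_mem; rewrite !inE eb.
have cutD0 : nonempty_cut G D0.
  apply/andP; split.
    by apply/set0Pn; exists b; rewrite inE (subsetP TG) //= indT.
  (* The component of an end of b in T minus b. *)
  apply/existsP; exists [set v | connect (adj G (T :\ b)) (ends G b).1 v].
  apply/eqP/setP=> e; rewrite !inE; case eG: (e \in edges G) => //=.
  set c := connect _; apply/idP/idP => [neb | ].
    have := spT e eG; rewrite /spans -{1}(setD1K bT) => /connect_setU1.
    have fund_adj : ~~ c (ends G b).1 (ends G b).2 by have := indT b bT.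
    case=> [s | [h1 h2] | [h1 h2]]; first by rewrite /spans s in neb.
      rewrite /c adj_sym h1 addTb; apply: contra fund_adj => h; apply: connect_trans h _.
      by rewrite adj_sym.
    rewrite addbC /c h2 addTb; apply: contra fund_adj => h; apply: connect_trans h h1.
  apply: contraTN; rewrite /spans => s.
  by rewrite /c (same_connect_r (@adj_sym _ _ _ _) s) addbb.
apply: (iffP andP) => [[/minsetP[cD _] sD] | ->]; first exact: sub_ex.
split=> //; apply/minsetP; split=> // D' cD' sD'; apply: sub_ex cD'.
exact: subset_trans subD0.
Qed.

(** Comparison with [fundamental_cocycleP] shows that b is on the fundamental
    cycle of e if and only if e is in the fundamental cocycle of b. *)
Lemma fundamental_cycleP G T e C : spanning_tree G T -> e \in edges G :\: T ->
  reflect (C = e |: [set b in T | ~~ spans G (T :\ b) e])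
          (fundamental_cycle G T e C).
Proof.
move=> tT; rewrite inE => /andP[eT eG]; have /spanning_treeP[TG indT spT] := tT.
have [fT maxT] := maxsetP tT.
set C0 := _ |: _.
have uniq_cycle C' : is_cycle G C' -> C' \subset e |: T -> C' = C0.
  move=> cC sC.
  have eC : e \in C'.
    apply: contraT => eC; have /andP[_ /forallP/(_ C')] := fT; rewrite cC /=.
    case/negP; apply/subsetP => f fC; case/setU1P: (subsetP sC f fC) => [fe|//].
    by rewrite -fe fC in eC.
  apply/setP => b; rewrite !inE; have [-> // | be] /= := eqVneq b e.
  have [bT | bT] /= := boolP (b \in T); last first.
    by apply: contraNF bT => /(subsetP sC); rewrite !inE (negbTE be).
  have subCb f : f \in C' -> f != b -> f != e -> f \in T :\ b.
    by move=> /(subsetP sC); rewrite !inE => /orP[-> | -> ->].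
  apply/idP/idP=> [bC | ].
    apply: contra (indT b bT) => sbe; apply: spans_trans (cycle_spans cC bC) => f.
    rewrite !inE => /andP[fb fC]; have [-> // | fe] := eqVneq f e.
    by apply: spans_mem; apply: subCb.
  apply: contraNT => bC; apply: spansS (cycle_spans cC eC).
  apply/subsetP=> f; rewrite in_setD1 => /andP[fe fC]; apply: subCb => //.
  by apply: contraNneq bC => <-.
have exC : exists2 C, is_cycle G C & C \subset e |: T.
  apply: (@dependent_cycle _ _ _ _ e); rewrite ?setU11 ?setU1K ?spT //.
  by rewrite subUset sub1set eG.
apply: (iffP andP) => [[cC sC] | ->]; first exact: uniq_cycle.
by case: exC => C1 cC1 sC1; rewrite -(uniq_cycle C1).
Qed.

End Trees.

(** * The fundamental graph of a spanning tree, and minors *)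

Section Minors.
Variables V E : finType.
Implicit Types (G H : graph V E) (F T C D A B : {set E}) (X : {set V}) (e f b : E).

(** The spanning trees of G(F), without forming the restricted graph. *)
Definition basis G F T :=
  [/\ T \subset F, {in T, forall e, ~~ spans G (T :\ e) e} & {in F, forall e, spans G T e}].

(** The fundamental graph of T, made symmetric. *)
Definition fund_adj G T x y :=
  [&& x \in edges G, y \in edges G
    & [&& x \in T, y \notin T & ~~ spans G (T :\ x) y]
      || [&& y \in T, x \notin T & ~~ spans G (T :\ y) x]].

Lemma edges_minor G F F' : F \subset edges G -> edges (minor G F F') = F :\: F'.
Proof. by move=> FG; rewrite /= (setIidPr FG). Qed.

(** Each vertex is joined by edges of F' to the representative that replaces it
    in the contraction. *)
Lemma spans_minor G F F' A e : F' \subset F -> F \subset edges G ->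
  spans (minor G F F') A e = spans G (A :|: F') e.
Proof.
move=> F'F FG; set H := minor G F F'; pose r := fingraph.root (adj G F').
have endsH f : ends H f = (r (ends G f).1, r (ends G f).2).
  by rewrite /H /minor /contract /= (setIidPr FG) (setIidPr F'F).
have cr u : connect (adj G F') u (r u) by apply: connect_root.
have crA u : connect (adj G (A :|: F')) u (r u).
  by apply: connect_sub (cr u) => x y /existsP[f /andP[fF h]];
    apply/connect1/existsP; exists f; rewrite inE fF orbT.
have GH u v : connect (adj G (A :|: F')) u v -> connect (adj H A) (r u) (r v).
  case/connectP=> p; elim: p u => [u _ -> | w p IHp u /= /andP[uw /IHp{}IHp] /IHp{IHp}].
    exact: connect0.
  apply: connect_trans; case/existsP: uw => f /andP[/setUP[fA | fF] ef].
    apply/connect1/existsP; exists f; rewrite fA endsH.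
    by case/orP: ef => /eqP->; rewrite eqxx ?orbT.
  suff -> : r u = r w by apply: connect0.
  apply/eqP; rewrite /r (root_connect (@adj_sym _ _ _ _)); apply/connect1/existsP; exists f.
  by rewrite fF ef.
have HG u v : connect (adj H A) u v -> connect (adj G (A :|: F')) u v.
  apply: connect_sub => x y /existsP[f /andP[fA]].
  have fE : connect (adj G (A :|: F')) (r (ends G f).1) (r (ends G f).2).
    apply: connect_trans (crA _); rewrite adj_sym; apply: connect_trans (crA _).
    by rewrite adj_sym; apply/connect1/adj_end; rewrite inE fA.
  by rewrite endsH => /orP[]/eqP[<- <-]; rewrite // adj_sym.
rewrite /spans endsH /=; apply/idP/idP => [/HG h | /GH //].
apply: connect_trans (crA _) (connect_trans h _).
by rewrite adj_sym.
Qed.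

Lemma basis_tree G T : reflect (basis G (edges G) T) (spanning_tree G T).
Proof. exact: spanning_treeP. Qed.

Lemma basis0 G : basis G set0 set0.
Proof. by split=> // e; rewrite inE. Qed.

Lemma basis_restrict G F T : spanning_tree G T -> {in F, forall e, spans G (T :&: F) e} ->
  basis G F (T :&: F).
Proof.
case/spanning_treeP=> TG indT _ spF; split=> // [|e]; first exact: subsetIr.
case/setIP=> eT eF; apply: contra (indT e eT); apply: spansS.
by apply: setSD; apply: subsetIl.
Qed.

(** If an edge e of T1 were spanned by the rest of the union, exchange with an
    edge f of T2, taken from a minimal set needed to span e, would make f
    dependent on T2 minus f modulo F1. *)
Lemma basis_minor G F1 F2 T1 T2 : F1 \subset F2 -> F2 \subset edges G ->
  basis G F1 T1 -> spanning_tree (minor G F2 F1) T2 -> basis G F2 (T1 :|: T2).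
Proof.
move=> F12 F2G [T1F ind1 sp1] /spanning_treeP.
rewrite edges_minor // => -[T2F ind2 sp2].
have T12 : [disjoint T1 & T2].
  rewrite disjoint_sym disjoints_subset; apply/subsetP => e /(subsetP T2F).
  by rewrite !inE => /andP[+ _]; apply: contra => /(subsetP T1F).
split.
- rewrite subUset (subset_trans T1F) //=; apply: subset_trans T2F _; exact: subsetDl.
- have ind2' : {in T2, forall e, ~~ spans G (F1 :|: T2 :\ e) e}.
    by move=> e /ind2; rewrite spans_minor // setUC.
  move=> e; case/setUP=> [eT1 | eT2].
    rewrite setDUl (setDidPl _ : T2 :\ e = T2);
      last by rewrite disjoint_sym disjoints1 (disjointFr T12).
    apply/negP=> se.
    (* B is a minimal part of T2 that spans e together with T1 minus e. *)
    have [B /minsetP[/= sBe minB] BT] :=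
      minset_exists (P := fun B => spans G (T1 :\ e :|: B) e) se.
    have [B0 | [f fB]] := set_0Vmem B.
      by case/negP: (ind1 e eT1); rewrite B0 setU0 in sBe.
    have nBe : ~~ spans G (T1 :\ e :|: B :\ f) e.
      apply/negP=> /minB/(_ (subsetDl _ _)) eB.
      by move: fB; rewrite -eB !inE eqxx.
    case/negP: (ind2' f (subsetP BT f fB)).
    have := sBe; rewrite -{1}(setD1K fB) setUCA => /spans_exchange/(_ nBe).
    apply: spansS; rewrite setUA setD1K // setUSS //.
    exact: setSD.
  have := ind2' e eT2; apply: contra; apply: spans_trans => f.
  by rewrite !inE => /andP[fe /orP[/(subsetP T1F) | ] fT]; apply: spans_mem;
    rewrite !inE fT ?fe ?orbT.
move=> e eF2; have [eF1 | eF1] := boolP (e \in F1).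
  by apply: spansS (sp1 e eF1); apply: subsetUl.
have : spans G (T2 :|: F1) e by rewrite -(@spans_minor _ F2) // sp2 // inE eF1.
apply: spans_trans => f /setUP[fT | /sp1]; last by apply: spansS; apply: subsetUl.
by apply: spans_mem; rewrite inE fT orbT.
Qed.

Lemma minor_basis G F1 F2 T : F1 \subset F2 -> F2 \subset edges G ->
  basis G F1 (T :&: F1) -> basis G F2 (T :&: F2) ->
  spanning_tree (minor G F2 F1) (T :&: (F2 :\: F1)).
Proof.
move=> F12 F2G [_ _ sp1] [_ ind2 sp2]; apply/spanning_treeP; rewrite edges_minor //.
split=> [|e|e]; first exact: subsetIr.
  rewrite !inE => /and3P[eT eF1 eF2]; rewrite spans_minor //.
  have /ind2 : e \in T :&: F2 by rewrite inE eT.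
  apply: contra; apply: spans_trans => f.
  rewrite !inE => /orP[/and4P[fe fT _ fF2] | fF1]; first by apply: spans_mem;
    rewrite !inE fe fT.
  apply: spansS (sp1 f fF1); apply/subsetP => g.
  rewrite !inE => /andP[-> gF1]; rewrite (subsetP F12) //= !andbT.
  by apply: contraNneq eF1 => <-.
rewrite !inE => /andP[eF1 eF2]; rewrite spans_minor //.
apply: spans_trans (sp2 e eF2) => f; rewrite inE => /andP[fT fF2].
by apply: spans_mem; rewrite !inE fT fF2 andbT; case: (f \in F1).
Qed.

Lemma fund_adj_minor G F1 F2 T : F1 \subset F2 -> F2 \subset edges G ->
  spanning_tree G T -> basis G F1 (T :&: F1) -> basis G F2 (T :&: F2) ->
  {in F2 :\: F1 &, forall x y, fund_adj (minor G F2 F1) (T :&: (F2 :\: F1)) x y = fund_adj G T x y}.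
Proof.
move=> F12 F2G /spanning_treeP[TG indT spT] [_ _ sp1] [_ ind2 sp2].
set A := F2 :\: F1.
have key x y : x \in A -> y \in A -> x \in T ->
    spans (minor G F2 F1) (T :&: A :\ x) y = spans G (T :\ x) y.
  rewrite ![_ \in A]inE => /andP[xF1 xF2] /andP[yF1 yF2] xT; rewrite spans_minor //.
  apply/idP/idP.
    apply: spans_trans => f; rewrite !inE => /orP[/and4P[fx fT _ _] | fF1].
      by apply: spans_mem; rewrite !inE fx.
    apply: spansS (sp1 f fF1); apply/subsetP => g.
    rewrite !inE => /andP[-> gF1]; rewrite andbT.
    by apply: contraNneq xF1 => <-.
  have xTF : x \in T :&: F2 by rewrite inE xT.
  move=> sx; apply: (@spansS _ _ _ _ (T :&: F2 :\ x)).
    apply/subsetP=> f; rewrite !inE => /and3P[-> -> ->]; rewrite andbT.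
    by case: (f \in F1).
  apply: contraT => nx; case/negP: (indT x xT).
  have := sp2 y yF2; rewrite -{1}(setD1K xTF) => /spans_exchange/(_ nx).
  apply: spans_trans => f /setU1P[-> // | fT]; apply: spans_mem.
  by move: fT; rewrite !inE => /and3P[-> ->].
move=> x y xA yA; rewrite /fund_adj edges_minor // -/A xA yA !in_setI xA yA !andbT.
have AG : A \subset edges G by apply: subset_trans F2G; apply: subsetDl.
rewrite !(subsetP AG) //=.
by congr (_ || _); [case xT: (x \in T) | case yT: (y \in T)]; rewrite //= key.
Qed.

Lemma fund_adj_sym G T : symmetric (fund_adj G T).
Proof. by move=> x y; rewrite /fund_adj andbCA orbC. Qed.

Lemma fund_adj_bip G T x y : fund_adj G T x y -> (x \in T) = (y \notin T).
Proof. by case/and3P=> _ _ /orP[]/and3P[-> + _] => [-> | /negbTE]. Qed.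

Lemma fund_adj_edge G T x y : fund_adj G T x y -> x \in edges G.
Proof. by case/and3P. Qed.

(** Spanning F by edges of F amounts to F containing the fundamental cycles of
    its edges, hence a condition on the fundamental graph alone. *)
Lemma basis_stable G F T : spanning_tree G T -> F \subset edges G ->
  basis G F (T :&: F) <->
  (forall b e, b \in T -> fund_adj G T b e -> e \in F -> b \in F).
Proof.
move=> tT FG; have /spanning_treeP[TG indT spT] := tT; split.
  move=> [_ _ spF] b e bT be eF; have := fund_adj_bip be; rewrite bT => /esym eT.
  case/and3P: be => _ _; rewrite bT eT (negbTE eT) orbF /=; apply: contraNT => bF.
  apply: spansS (spF e eF); apply/subsetP=> f; rewrite !inE => /andP[-> fF].
  by rewrite andbT; apply: contraNneq bF => <-.
move=> st; apply: basis_restrict => // e eF.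
have [eT | eT] := boolP (e \in T); first by apply: spans_mem; rewrite inE eT.
apply: tree_support (spT e (subsetP FG e eF)) _ => // b bT sbe.
by apply: (st b e) => //; rewrite /fund_adj (subsetP TG) // (subsetP FG) //= bT eT sbe.
Qed.

End Minors.

(** * Activities read off the fundamental graph *)

Section ActiveElements.
Variables (d : Order.disp_t) (V : finType) (E : finOrderType d).
Implicit Types (G H : graph V E) (T A : {set E}) (r : rel E).

(** Over the whole edge set and with the fundamental graph for r, these are the
    active edges of both kinds; the restriction to A gives those of the
    minors. *)
Definition act r A x := (x \in A) && [forall y in A, r x y ==> (x < y)%O].

Lemma internal_activityE G T : spanning_tree G T ->
  internal_activity G T = #|[set x in T | act (fund_adj G T) (edges G) x]|.
Proof.
move=> tT; have /spanning_treeP[TG indT spT] := tT.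
apply: eq_card => b; rewrite !inE; case bT: (b \in T) => //=.
have bG := subsetP TG b bT; rewrite /act bG /=.
apply/existsP/forall_inP => [[D /andP[/(fundamental_cocycleP _ tT bT)-> /andP[bD /forall_inP minD]]] | h].
  move=> e eG; apply/implyP=> /[dup] /fund_adj_bip; rewrite bT => /esym eT.
  case/and3P=> _ _; rewrite bT eT (negbTE eT) orbF /= => nbe.
  rewrite lt_neqAle minD ?inE ?eG // andbT.
  by apply: contraNneq eT => <-.
exists [set e in edges G | ~~ spans G (T :\ b) e]; apply/andP; split.
  exact/(fundamental_cocycleP _ tT bT).
apply/andP; split; first by rewrite inE bG indT.
apply/forall_inP=> e; rewrite inE => /andP[eG nbe].
have [eT | eT] := boolP (e \in T).
  have [-> // | eb] := eqVneq e b; case/negP: nbe; apply: spans_mem.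
  by rewrite !inE eb.
have /implyP := h e eG; rewrite /fund_adj bG eG bT eT nbe /= => /(_ isT).
exact: ltW.
Qed.

Lemma external_activityE G T : spanning_tree G T ->
  external_activity G T = #|[set x in edges G :\: T | act (fund_adj G T) (edges G) x]|.
Proof.
move=> tT; have /spanning_treeP[TG indT spT] := tT.
apply: eq_card => e; rewrite !in_set; case eN: (e \in edges G :\: T) => /=;
  last by move: eN; rewrite !inE => ->.
have := eN; rewrite inE => /andP[eT eG]; rewrite eT /act eG /=.
apply/existsP/forall_inP => [[C /andP[/(fundamental_cycleP _ tT eN)-> /andP[eC /forall_inP minC]]] | h].
  move=> b bG; apply/implyP=> /[dup] /fund_adj_bip; rewrite (negbTE eT) => /esym/negbFE bT.
  case/and3P=> _ _; rewrite bT eT (negbTE eT) /= => nbe.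
  rewrite lt_neqAle minC ?inE ?bT ?nbe ?orbT // andbT.
  by apply: contraNneq eT => ->.
exists (e |: [set b in T | ~~ spans G (T :\ b) e]); apply/andP; split.
  exact/(fundamental_cycleP _ tT eN).
apply/andP; split; first by rewrite setU11.
apply/forall_inP=> b; rewrite !inE => /predU1P[-> // | /andP[bT nbe]].
have bG := subsetP TG b bT.
have /implyP := h b bG; rewrite /fund_adj bG eG bT eT nbe (negbTE eT) /= => /(_ isT).
exact: ltW.
Qed.

End ActiveElements.

(** * Ranks and minima in finite orders *)

Section FinOrder.
Variables (d : Order.disp_t) (E : finOrderType d).
Implicit Types (A B J : {set E}) (x y : E).

Lemma finlt_ind (P : E -> Prop) :
  (forall x, (forall y, (y < x)%O -> P y) -> P x) -> forall x, P x.
Proof.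
move=> IH x; have [n] := ubnP #|[set y | (y < x)%O]|.
elim: n x => // n IHn x xn; apply: IH => y yx; apply: IHn.
rewrite ltnS in xn; apply: leq_trans xn; apply: proper_card.
apply/properP; split; last by exists y; rewrite inE ?yx ?ltxx.
by apply/subsetP=> z; rewrite !inE => /lt_trans; apply.
Qed.

Lemma is_minP (a : E) A : reflect (a \in A /\ {in A, forall f, (a <= f)%O}) (is_min a A).
Proof. by apply: (iffP andP) => -[aA /forall_inP]. Qed.

Lemma ex_is_min A : A != set0 -> exists a, is_min a A.
Proof.
case/set0Pn=> x; elim/finlt_ind: x => x IHx xA.
have [/exists_inP[y yA yx] | h] := boolP [exists y in A, (y < x)%O].
  exact: IHx yx yA.
exists x; apply/is_minP; split=> // y yA; rewrite leNgt.
by apply: contra h => yx; apply/exists_inP; exists y.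
Qed.

Lemma is_min_uniq (a b : E) A : is_min a A -> is_min b A -> a = b.
Proof.
move=> /is_minP[aA ha] /is_minP[bA hb]; apply/eqP.
by rewrite eq_le ha // hb.
Qed.

(** The position of x in the increasing enumeration of J, counted from 0. *)
Definition rank_in J x := #|[set y in J | (y < x)%O]|.

Lemma rank_in_lt J x y : x \in J -> (x < y)%O -> rank_in J x < rank_in J y.
Proof.
move=> xJ xy; apply: proper_card; apply/properP; split.
  by apply/subsetP=> z; rewrite !inE => /andP[-> /lt_trans]; apply.
by exists x; rewrite !inE xJ ?xy ?ltxx.
Qed.

Lemma rank_in_inj J : {in J &, injective (rank_in J)}.
Proof.
move=> x y xJ yJ; have [/(rank_in_lt xJ) | /(rank_in_lt yJ) | //] := ltgtP x y => + e.
  by rewrite e ltnn.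
by rewrite e ltnn.
Qed.

Lemma rank_in_card J x : x \in J -> rank_in J x < #|J|.
Proof.
move=> xJ; apply: proper_card; apply/properP; split.
  by apply/subsetP=> z; rewrite !inE => /andP[].
by exists x; rewrite ?inE ?ltxx ?andbF.
Qed.

Lemma rank_in_surj J k : k < #|J| -> exists2 x, x \in J & rank_in J x = k.
Proof.
move=> kJ; pose f (x : E) : option 'I_#|J| := insub (rank_in J x).
have fE x : x \in J -> exists2 q : 'I_#|J|, f x = Some q & rank_in J x = q.
  move=> /rank_in_card xJ; exists (Ordinal xJ) => //.
  by rewrite /f insubT.
have fI : {in J &, injective f}.
  move=> x y xJ yJ; have [[q -> eq] [q' -> eq']] := (fE x xJ, fE y yJ) => -[qq].
  by apply: (rank_in_inj xJ yJ); rewrite eq eq' qq.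
have : [set f x | x in J] = [set Some q | q in 'I_#|J|].
  apply/eqP; rewrite eqEcard card_in_imset // card_imset ?card_ord; last exact: Some_inj.
  rewrite leqnn andbT; apply/subsetP => _ /imsetP[x xJ ->].
  by have [q -> _] := fE x xJ; apply: imset_f.
move/setP/(_ (Some (Ordinal kJ))); rewrite imset_f //=; case/imsetP=> x xJ ef.
by exists x => //; have [q eq ->] := fE x xJ; move: ef; rewrite eq => -[<-].
Qed.

(** Identifies the minima of the parts of a filtration: listed in increasing
    order, they have rank equal to their index. *)
Lemma rank_in_image n (m : 'I_n -> E) :
  (forall k l : 'I_n, k < l -> (m k < m l)%O) ->
  forall k, rank_in [set m l | l in 'I_n] (m k) = k.
Proof.
move=> inc k; have mI : injective m.
  move=> l l' e; apply/val_inj/eqP; have [/inc | /inc | //] := ltngtP l l';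
  by rewrite e ltxx.
have lt_m l l' : (m l < m l')%O = (l < l').
  by have [/inc | /inc /ltW | /val_inj->] := ltngtP l l'; [| rewrite leNgt =>
    /negbTE | rewrite ltxx].
rewrite /rank_in; transitivity #|[set m l | l in [set l : 'I_n | l < k]]|.
  apply: eq_card => y; rewrite inE; apply/andP/imsetP=> [[/imsetP[l _ ->]] | [l]].
    by rewrite lt_m => lk; exists l; rewrite ?inE.
  by rewrite inE => lk ->; rewrite lt_m imset_f.
rewrite card_imset // -sum1dep_card (big_ord_narrow (ltnW (ltn_ord k))) /=.
by rewrite sum1_card card_ord.
Qed.

End FinOrder.

(** * Filtrations as pairs of chains *)

Section Chains.
Variables (E : finType).
Implicit Types (F : nat -> {set E}).

Lemma chain_sub F n : (forall k, k < n -> F k \subset F k.+1) ->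
  forall k l, k <= l <= n -> F k \subset F l.
Proof.
move=> inc k l /andP[kl ln]; elim: l kl ln => [|l IHl].
  by rewrite leqn0 => /eqP->.
rewrite leq_eqVlt => /predU1P[-> // | kl] ln.
by apply: subset_trans (inc l ln); apply: IHl => //; apply: ltnW.
Qed.

Lemma antichain_sub F n : (forall k, k < n -> F k.+1 \subset F k) ->
  forall k l, k <= l <= n -> F l \subset F k.
Proof.
move=> dec k l; rewrite -setCS; apply: (@chain_sub (fun k => ~: F k)) => q qn.
by rewrite setCS dec.
Qed.

Lemma chain_cover F n x : x \notin F 0 -> x \in F n ->
  exists2 k, k < n & x \in F k.+1 :\: F k.
Proof.
move=> x0; elim: n => [x1 | n IHn xn]; first by rewrite x1 in x0.
have [/IHn[k kn xk] | xNn] := boolP (x \in F n); first by exists k; rewrite // ltnW.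
by exists n; rewrite // inE xNn.
Qed.

End Chains.

Section Filtered.
Variables (d : Order.disp_t) (E : finOrderType d) (X : {set E}).
Implicit Types (F : nat -> {set E}) (x : E).

(** The two chains of a filtration as functions of the index, constrained only
    at indices up to j and i; the middle set is F' 0 = F 0. *)
Definition filtered (F' F : nat -> {set E}) j i : Prop :=
  [/\ F' j = set0, F' 0 = F 0 & F i = X] /\
  [/\ forall k, k < i -> F k \proper F k.+1,
      forall k, k < j -> F' k.+1 \proper F' k,
      forall k l a b, k < l < i -> is_min a (F k.+1 :\: F k) ->
        is_min b (F l.+1 :\: F l) -> (a < b)%O
    & forall k l a b, k < l < j -> is_min a (F' k :\: F' k.+1) ->
        is_min b (F' l :\: F' l.+1) -> (a < b)%O].

Variables (F' F : nat -> {set E}) (j i : nat).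

(** Lower parts are indexed on the left, upper parts on the right. *)
Definition part (p : 'I_j + 'I_i) := match p with
  | inl k => F' k :\: F' k.+1 | inr k => F k.+1 :\: F k end.

Definition internal (p : 'I_j + 'I_i) := if p is inr _ then true else false.

Hypothesis filtF : filtered F' F j i.

Lemma filtered_sub k l : k <= l <= i -> F k \subset F l.
Proof. by case: filtF => _ [h _ _ _]; apply: chain_sub => q /h/proper_sub. Qed.

Lemma filtered_sub' k l : k <= l <= j -> F' l \subset F' k.
Proof. by case: filtF => _ [_ h _ _]; apply: antichain_sub => q /h/proper_sub. Qed.

Lemma filtered_sub0 k l : k <= j -> l <= i -> F' k \subset F l.
Proof.
case: filtF => -[_ F0 _] _ kj li; apply: (@subset_trans _ _ (F' 0));
  first exact: filtered_sub'.
by rewrite F0; apply: filtered_sub.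
Qed.

Lemma filtered_subX k : k <= i -> F k \subset X.
Proof. by case: filtF => -[_ _ <-] _ ki; apply: filtered_sub; rewrite ki leqnn. Qed.

Lemma filtered_subX' k : k <= j -> F' k \subset X.
Proof. by move=> kj; apply: subset_trans (filtered_sub0 kj (leq0n i)) (filtered_subX _). Qed.

Lemma part_subX p : part p \subset X.
Proof.
by case: p => k; apply: subset_trans (subsetDl _ _) _;
  [apply: filtered_subX'; apply: ltnW | apply: filtered_subX].
Qed.

Lemma part_neq0 p : part p != set0.
Proof.
case: filtF => _ [h h' _ _].
by case: p => k; rewrite setD_eq0; [have := h' k | have := h k];
  rewrite ltn_ord properE => /(_ isT)/andP[].
Qed.

Lemma part_cover x : x \in X -> exists p, x \in part p.
Proof.
case: filtF => -[F'j F0 Fi] _; rewrite -Fi => xi.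
have [x0 | x0] := boolP (x \in F 0); last first.
  by have [k ki xk] := chain_cover x0 xi; exists (inr (Ordinal ki)).
have [||k kj xk] := @chain_cover _ (fun k => ~: F' k) j x.
- by rewrite F0 inE x0.
- by rewrite F'j !inE.
by exists (inl (Ordinal kj)); move: xk; rewrite !inE negbK andbC.
Qed.

(** Every set of the chains is a union of parts; this and [part_mem'] say
    of which ones. *)
Lemma part_mem l p x : l <= i -> x \in part p ->
  (x \in F l) = (if p is inr k then k < l else true).
Proof.
move=> li; case: p => k; rewrite inE => /andP[x1 x2].
  by apply: subsetP x2; apply: filtered_sub0 => //; apply: ltnW.
case: ltnP => [kl | lk]; first by apply: subsetP x2; apply: filtered_sub; rewrite kl.
by apply: contraNF x1; apply/subsetP/filtered_sub; rewrite lk ltnW.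
Qed.

Lemma part_mem' l p x : l <= j -> x \in part p ->
  (x \in F' l) = (if p is inl k then l <= k else false).
Proof.
move=> lj; case: p => k; rewrite inE => /andP[x1 x2]; last first.
  by apply: contraNF x1; apply/subsetP/filtered_sub0; rewrite // ltnW.
case: leqP => [lk | kl]; first by apply: subsetP x2; apply: filtered_sub'; rewrite lk ltnW.
by apply: contraNF x1; apply/subsetP/filtered_sub'; rewrite kl.
Qed.

Lemma part_inj p q x : x \in part p -> x \in part q -> p = q.
Proof.
move=> xp xq.
have h l : l <= i -> (if p is inr k then k < l else true) = (if q is inr k then k < l else true).
  by move=> li; rewrite -(part_mem li xp) (part_mem li xq).
have h' l : l <= j -> (if p is inl k then l <= k else false) = (if q is inl k then l <= k else false).
  by move=> lj; rewrite -(part_mem' lj xp) (part_mem' lj xq).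
case: p q {xp xq} h h' => k [] l h h'.
- have := (h' k (ltnW (ltn_ord k)), h' l (ltnW (ltn_ord l))); rewrite !leqnn => -[kl lk].
  by congr inl; apply/val_inj/eqP; rewrite eqn_leq -kl lk.
- by have := h' 0 isT.
- by have := h' 0 isT.
have := (h k.+1 (ltn_ord k), h l.+1 (ltn_ord l)); rewrite !ltnS !leqnn => -[lk kl].
by congr inr; apply/val_inj/eqP; rewrite eqn_leq kl -lk.
Qed.

End Filtered.

(** * The unique decomposition of an ordered bipartite graph *)

Section OrderedBipartite.
Variables (d : Order.disp_t) (E : finOrderType d) (X T : {set E}) (r : rel E).
Hypothesis (rS : symmetric r).
Hypotheses (rB : forall x y, r x y -> (x \in T) = (y \notin T)).
Hypotheses (rX : forall x y, r x y -> x \in X).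
Implicit Types (A B S : {set E}) (x y : E) (F : nat -> {set E}).

Let active := act r X.
Let I := [set x in T | active x].
Let J := [set x in X :\: T | active x].

Lemma r_neq x y : r x y -> x != y.
Proof. by move=> /rB xy; apply: contra_eq_neq xy => ->; case: (y \in T). Qed.

Lemma not_act_lt A x : x \in A -> ~~ act r A x -> exists y, [/\ y \in A, r x y & (y < x)%O].
Proof.
rewrite /act => -> /= /forall_inPn[y yA]; rewrite negb_imply -leNgt => /andP[xy yx].
by exists y; rewrite lt_neqAle yx eq_sym r_neq.
Qed.

Lemma act_lt A x y : act r A x -> y \in A -> r x y -> (x < y)%O.
Proof. by case/andP=> _ /forall_inP h yA xy; have /implyP := h y yA; apply. Qed.

(** For the fundamental graph of T: A contains the fundamental cycles of its
    elements outside T, see [basis_stable]. *)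
Definition stable A := forall b e, b \in T -> r b e -> e \in A -> b \in A.

(** One step of the rule that decides membership of a nonactive element from
    its smaller neighbours. *)
Definition propagate1 B S := [set x in X | if active x then x \in B else
  if x \in T then [exists y, [&& r x y, (y < x)%O & y \in S]]
  else [forall y, r x y && (y < x)%O ==> (y \in S)]].

Lemma propagate1_local B S1 S2 x :
  (forall y, (y < x)%O -> (y \in S1) = (y \in S2)) ->
  (x \in propagate1 B S1) = (x \in propagate1 B S2).
Proof.
move=> S12; rewrite !inE; congr (_ && _); case: ifP => // _; case: ifP => _.
  by apply: eq_existsb => y; case yx: (y < x)%O; rewrite ?andbF // S12.
by apply: eq_forallb => y; case yx: (y < x)%O; rewrite ?andbF // S12.
Qed.

(** The fixed point of [propagate1]: membership of x depends on smaller
    elements only, so it is settled after one step more than there are elements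
    below x. *)
Definition propagate B := iter #|E|.+1 (propagate1 B) set0.

Lemma propagateE B : propagate B = propagate1 B (propagate B).
Proof.
suff stab n x : #|[set y | (y < x)%O]| < n ->
    (x \in iter n (propagate1 B) set0) = (x \in iter n.+1 (propagate1 B) set0).
  by apply/setP=> x; apply: stab; rewrite ltnS max_card.
elim: n x => // n IHn x xn; apply: propagate1_local => y yx; apply: IHn.
rewrite ltnS in xn; apply: leq_trans xn; apply: proper_card.
apply/properP; split; last by exists y; rewrite inE ?yx ?ltxx.
by apply/subsetP=> z; rewrite !inE => /lt_trans; apply.
Qed.

Lemma propagate_mem B x : (x \in propagate B) = (x \in X) && (if active x then x \in B else
  if x \in T then [exists y, [&& r x y, (y < x)%O & y \in propagate B]]
  else [forall y, r x y && (y < x)%O ==> (y \in propagate B)]).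
Proof. by rewrite {1}propagateE in_set. Qed.

Lemma propagate_uniq B S : S = propagate1 B S -> S = propagate B.
Proof.
move=> eS; apply/setP; elim/finlt_ind => x IHx.
by rewrite eS propagateE; apply: propagate1_local.
Qed.

(** Closedness and the existence, for nonactive x, of a smaller neighbour on
    the same side of S leave no freedom beyond the choice of the active
    elements. *)
Lemma stable_propagateE B S : S \subset X -> stable S ->
  (forall x, x \in X -> ~~ active x ->
     exists y, [/\ r x y, (y < x)%O & (y \in S) = (x \in S)]) ->
  (forall x, active x -> (x \in S) = (x \in B)) -> S = propagate B.
Proof.
move=> /subsetP SX st near SB; apply: propagate_uniq; apply/setP=> x; rewrite inE.
have [xX | xX] /= := boolP (x \in X); last by apply: contraNF xX => /SX.
case: ifP => [/SB // | /negbT nx]; have [y [xy yx yS]] := near x xX nx.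
case: ifP => xT.
  apply/idP/existsP => [xS | [z /and3P[xz _ zS]]]; last exact: st xz zS.
  by exists y; rewrite xy yx yS.
apply/idP/forallP => [xS z | /(_ y)]; last by rewrite xy yx yS.
apply/implyP=> /andP[xz _]; apply: st xS; last by rewrite rS.
by have := rB xz; rewrite xT => /esym/negbFE.
Qed.

Lemma propagate_sub B : propagate B \subset X.
Proof. by apply/subsetP=> x; rewrite propagate_mem => /andP[]. Qed.

Lemma propagate_active B x : active x -> (x \in propagate B) = (x \in B).
Proof. by move=> ax; rewrite propagate_mem ax (andP ax).1. Qed.

Lemma propagate_stable B : stable (propagate B).
Proof.
move=> b e bT be; have := rB be; rewrite bT => /esym/negbTE eT.
have eb : r e b by rewrite rS.
have [b_e | e_b | eqbe] := ltgtP b e; last by have := r_neq be; rewrite eqbe eqxx.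
  rewrite (propagate_mem _ e) eT => /andP[eX]; case: ifP => [ae | _ /forallP/(_ b)].
    by have := act_lt ae (rX be) eb; rewrite ltNge ltW.
  by rewrite eb b_e.
move=> eS; rewrite (propagate_mem _ b) (rX be) bT /=; case: ifP => [ab | _].
  by have := act_lt ab (rX eb) be; rewrite ltNge ltW.
by apply/existsP; exists e; rewrite be e_b.
Qed.

Lemma propagate_mono B1 B2 : B1 \subset B2 -> propagate B1 \subset propagate B2.
Proof.
move=> /subsetP B12; apply/subsetP; elim/finlt_ind=> x IHx.
rewrite (propagate_mem B1) (propagate_mem B2) => /andP[-> /=]; case: ifP => [_ /B12 // | _].
case: ifP => _; [move=> /existsP[y /and3P[xy yx yS]] | move=> /forallP h].
  by apply/existsP; exists y; rewrite xy yx IHx.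
apply/forallP=> y; apply/implyP=> /andP[xy yx]; apply: IHx => //.
by have := h y; rewrite xy yx.
Qed.

Lemma nonactive_lt x : x \in X -> ~~ active x -> exists2 y, r x y & (y < x)%O.
Proof. by move=> xX /(not_act_lt xX)[y [_ xy yx]]; exists y. Qed.

(** This is why an element that is active in a difference of two propagated
    sets is active in the whole graph. *)
Lemma propagate_diff B1 B2 x : B1 \subset B2 ->
  x \in propagate B2 :\: propagate B1 -> ~~ active x ->
  exists y, [/\ r x y, (y < x)%O & y \in propagate B2 :\: propagate B1].
Proof.
move=> B12; rewrite inE => /andP[x1 x2] nx.
have xX := subsetP (propagate_sub B2) x x2; have [z xz zx] := nonactive_lt xX nx.
move: x1 x2; rewrite (propagate_mem B1) (propagate_mem B2) xX (negbTE nx) /=.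
case: ifP => _.
  rewrite negb_exists => /forallP h /existsP[y /and3P[xy yx y2]].
  by exists y; split=> //; rewrite inE y2 andbT; have := h y; rewrite xy yx.

rewrite negb_forall => /existsP[y]; rewrite negb_imply =>
  /andP[/andP[xy yx] y1] /forallP/(_ y).
by rewrite xy yx /= => y2; exists y; rewrite inE y1 y2.
Qed.

Lemma propagate0 : propagate set0 = set0.
Proof.
apply/esym/stable_propagateE; rewrite ?sub0set //.
  by move=> b e _ _; rewrite inE.
by move=> x xX /(nonactive_lt xX)[y xy yx]; exists y; rewrite !inE.
Qed.

Lemma propagateT B : (forall x, active x -> x \in B) -> propagate B = X.
Proof.
move=> aB; apply/esym/stable_propagateE => //.
- by move=> b e _ be _; apply: rX be.
- move=> x xX /(nonactive_lt xX)[y xy yx]; exists y; rewrite xX; split=> //.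
  by apply: (@rX y x); rewrite rS.
by move=> x ax; rewrite aB // (andP ax).1.
Qed.

(** The minimum of A is always active in A, so it is the only active element. *)
Definition uniactive (internal : bool) A :=
  exists2 m, is_min m A & (m \in T) = internal /\ forall x, act r A x -> x = m.

(** The filtrations through which T decomposes into trees with one active edge,
    in terms of the graph r only. *)
Definition decomposition (F' F : nat -> {set E}) j i :=
  [/\ filtered X F' F j i,
      forall k, k <= i -> stable (F k), forall k, k <= j -> stable (F' k)
    & forall p : 'I_j + 'I_i, uniactive (internal p) (part F' F p)].

Lemma decomposition_congr (F1' F1 F' F : nat -> {set E}) j i :
  (forall k, k <= j -> F1' k = F' k) -> (forall k, k <= i -> F1 k = F k) ->
  decomposition F1' F1 j i -> decomposition F' F j i.
Proof.
move=> e' e [[[F'j F0 Fi] [up dn mi mj]] st st' un].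
have eS k : k < i -> (F1 k.+1 = F k.+1) * (F1 k = F k) by move=> ki; rewrite !e // ltnW.
have eS' k : k < j -> (F1' k.+1 = F' k.+1) * (F1' k = F' k) by move=> kj;
  rewrite !e' // ltnW.
split=> [|k ki|k kj|p]; last first.
- by have := un p; case: p => k /=; [rewrite !eS' | rewrite !eS].
- by rewrite -e' //; apply: st'.
- by rewrite -e //; apply: st.
split; first by rewrite -!e' // -!e.
split=> [k ki|k kj|k l a b|k l a b].
- by rewrite -!eS //; apply: up.
- by rewrite -!eS' //; apply: dn.
- move=> /andP[kl li]; rewrite -!eS ?(ltn_trans kl) //; apply: mi; exact/andP.
move=> /andP[kl lj]; rewrite -!eS' ?(ltn_trans kl) //; apply: mj; exact/andP.
Qed.

Section Uniqueness.
Variables (F' F : nat -> {set E}) (j i : nat).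
Hypothesis decF : decomposition F' F j i.

Let filtF : filtered X F' F j i. Proof. by case: decF. Qed.
Let Part := @part d E F' F j i.

(** The minimum m of an upper part is in T, and by closedness its neighbours
    lie in the same or in higher parts, all of whose elements are at least m;
    dually for lower parts.  So the minima of the parts are active in the whole
    graph, and an element that is active in the whole graph is active in its
    part, hence its minimum. *)
Lemma decomposition_active : exists m : 'I_j + 'I_i -> E,
  [/\ forall p, is_min (m p) (Part p), forall p, (m p \in T) = internal p,
      forall p, active (m p), forall x, active x -> exists p, x = m p
    & forall x p, x \in Part p -> ~~ active x ->
        exists y, [/\ r x y, (y < x)%O & y \in Part p]].
Proof.
have [[_ [_ _ mi mj]] st st' un] := decF.
(* m p is the minimum of the part p. *)
have /fin_all_exists[m mP] : forall p, exists m, [/\ is_min m (Part p),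
    (m \in T) = internal p & forall x, act r (Part p) x -> x = m].
  by move=> p; have [m m1 [m2 m3]] := un p; exists m.
have mM p x : x \in Part p -> (m p <= x)%O.
  by have [/is_minP[_ h] _ _] := mP p; apply: h.
have mp p : m p \in Part p by have [/is_minP[]] := mP p.
have mact p : active (m p).
  apply/andP; split; first exact: subsetP (part_subX filtF p) _ (mp p).
  apply/forall_inP=> y /(part_cover filtF)[p' yp']; apply/implyP=> my.
  rewrite lt_neqAle r_neq //=; apply: le_trans (mM _ _ yp').
  have [_ mT _] := mP p; have := rB my; rewrite mT.
  case: p mT my (mp p) => k mT my mk.
    move/esym/negbFE => yT; have kj : k <= j := ltnW (ltn_ord k).
    have : y \in F' k.
      apply: (st' k kj _ (m (inl k))) => //; first by rewrite rS.
      by rewrite (part_mem' filtF kj mk) leqnn.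
    rewrite (part_mem' filtF kj yp'); case: p' yp' => // l yl.
    rewrite leq_eqVlt => /predU1P[/val_inj-> // | kl].
    by apply: ltW; apply: (mj k l); rewrite ?kl ?ltn_ord //; have [] := mP (inl k);
      have [] := mP (inl l).
  move/esym => yT; have ki : k <= i := ltnW (ltn_ord k).
  have : y \notin F k.
    have : m (inr k) \notin F k by rewrite (part_mem filtF ki mk) ltnn.
    by apply: contra; apply: st my.
  rewrite (part_mem filtF ki yp'); case: p' yp' => // l yl.
  rewrite -leqNgt leq_eqVlt => /predU1P[/val_inj-> // | kl].
  by apply: ltW; apply: (mi k l); rewrite ?kl ?ltn_ord //; have [] := mP (inr k);
    have [] := mP (inr l).
have nact x p : x \in Part p -> ~~ active x -> exists y, [/\ r x y, (y < x)%O &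
  y \in Part p].
  move=> xp nx; have : ~~ act r (Part p) x.
    apply: contra nx => ax; have [_ _ h] := mP p.
    by rewrite (h x ax).
  by case/(not_act_lt xp) => y [? ? ?]; exists y.
exists m; split=> //; try by move=> p; have [] := mP p.
move=> x ax; have [p xp] := part_cover filtF (andP ax).1.
exists p; have [_ _ h] := mP p; apply: h; apply/andP; split=> //.
apply/forall_inP=> y yp; apply/implyP; apply: (act_lt ax).
exact: subsetP (part_subX filtF p) _ yp.
Qed.

Let base k := J :|: [set b in I | rank_in I b < k].
Let base' k := [set e in J | k <= rank_in J e].

(** The active elements in F k are those of the lower parts and of the first k
    upper ones, those in F' k belong to the lower parts from k on; their
    ranks are known by [rank_in_image]. *)
Lemma decomposition_eq :
  [/\ #|I| = i, #|J| = j, forall k, k <= i -> F k = propagate (base k)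
    & forall k, k <= j -> F' k = propagate (base' k)].
Proof.
have [m [minm mT mact act_m near]] := decomposition_active.
have [[_ [_ _ inc inc']] st st' _] := decF.
have inc_r (k l : 'I_i) : k < l -> (m (inr k) < m (inr l))%O.
  by move=> kl; apply: (inc k l); rewrite ?kl ?ltn_ord //; apply: minm (inr _).
have inc_l (k l : 'I_j) : k < l -> (m (inl k) < m (inl l))%O.
  by move=> kl; apply: (inc' k l); rewrite ?kl ?ltn_ord //; apply: minm (inl _).
have inj n (f : 'I_n -> E) : (forall k l : 'I_n, k < l -> (f k < f l)%O) -> injective f.
  move=> incf l l' e; apply/val_inj/eqP; have [/incf | /incf | //] := ltngtP l l';
  by rewrite e ltxx.
have defI : I = [set m (inr k) | k in 'I_i].
  apply/setP=> x; rewrite inE; apply/andP/imsetP => [[xT /act_m[[k|k] ex]] | [k _ ->]].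
  - by have := mT (inl k); rewrite -ex xT.
  - by exists k.
  by rewrite mact mT.
have defJ : J = [set m (inl k) | k in 'I_j].
  apply/setP=> x; rewrite !inE; apply/andP/imsetP =>
    [[/andP[xT xX] /act_m[[k|k] ex]] | [k _ ->]].
  - by exists k.
  - by have := mT (inr k); rewrite -ex (negbTE xT).
  by rewrite mact mT (andP (mact _)).1.
have mp p : m p \in Part p by have /is_minP[] := minm p.
have near_mem S : (forall p x y, x \in Part p -> y \in Part p -> (x \in S) = (y \in S)) ->
    forall x, x \in X -> ~~ active x ->
    exists y, [/\ r x y, (y < x)%O & (y \in S) = (x \in S)].
  move=> hS x /(part_cover filtF)[p xp] /(near x p xp)[y [xy yx yp]].
  by exists y; split=> //; apply: hS yp xp.
split.
- by rewrite defI card_imset ?card_ord //; apply: inj.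
- by rewrite defJ card_imset ?card_ord //; apply: inj.
- move=> k ki; apply: stable_propagateE; [exact: filtered_subX filtF _ ki | exact: st | | ].
    by apply: near_mem => p x y xp yp; rewrite !(part_mem filtF ki (p := p)).
  move=> x /act_m[p ->]; rewrite (part_mem filtF ki (mp p)); case: p => l.
    by rewrite inE defJ imset_f.
  by rewrite in_setU !inE mT /= mact defI rank_in_image.
move=> k kj; apply: stable_propagateE; [exact: filtered_subX' filtF _ kj | exact: st' | | ].
  by apply: near_mem => p x y xp yp; rewrite !(part_mem' filtF kj (p := p)).
move=> x /act_m[p ->]; rewrite (part_mem' filtF kj (mp p)); case: p => l.
  by rewrite inE defJ rank_in_image // imset_f.
by rewrite !inE mT.
Qed.

End Uniqueness.

(** Consecutive propagated sets differ by one active element c; by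
    [propagate_diff], every other element of the difference has a smaller
    neighbour in it, whence c is the minimum and the only active element. *)
Lemma decomposition_exists :
  decomposition (fun k => propagate [set e in J | k <= rank_in J e])
    (fun k => propagate (J :|: [set b in I | rank_in I b < k])) #|J| #|I|.
Proof.
set B' := fun k => [set e in J | k <= rank_in J e].
set B := fun k => J :|: [set b in I | rank_in I b < k].
have IT x : x \in I -> x \in T by rewrite inE => /andP[].
have JT x : x \in J -> x \notin T by rewrite !inE => /andP[/andP[]].
have actI x : x \in I -> active x by rewrite inE => /andP[].
have actJ x : x \in J -> active x by rewrite inE => /andP[].
have actIJ x : active x -> (x \in J) = (x \notin T).
  by move=> ax; rewrite !inE ax (andP ax).1 !andbT.
have actII x : active x -> (x \in I) = (x \in T).
  by move=> ax; rewrite !inE ax !andbT.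
have memB x k : active x -> (x \in B k) = (x \in T) ==> (rank_in I x < k).
  move=> ax; rewrite in_setU actIJ // [x \in [set b in I | _]]inE actII //.
  by case: (x \in T).
have subB k : B k \subset B k.+1.
  by apply/setUS/subsetP=> x; rewrite !inE => /andP[-> /ltnW].
have subB' k : B' k.+1 \subset B' k.
  by apply/subsetP=> x; rewrite [x \in B' k.+1]inE [x \in B' k]inE => /andP[-> /ltnW].
have partP B1 B2 c : B1 \subset B2 -> active c -> c \in B2 :\: B1 ->
    (forall x, active x -> x \in B2 :\: B1 -> x = c) ->
    is_min c (propagate B2 :\: propagate B1) /\ (forall x,
      act r (propagate B2 :\: propagate B1) x -> x = c).
  move=> B12 ac cB cU; have cS : c \in propagate B2 :\: propagate B1.
    by move: cB; rewrite !in_setD !propagate_active.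
  have aS x : active x -> x \in propagate B2 :\: propagate B1 -> x = c.
    by move=> ax xS; apply: cU => //; move: xS; rewrite !in_setD !propagate_active.
  split.
    apply/is_minP; split=> //; elim/finlt_ind=> x IHx xS.
    have [/aS-> // | /(propagate_diff B12 xS)[y [_ yx yS]]] := boolP (active x).
    exact: le_trans (IHx y yx yS) (ltW yx).
  move=> x ax; have xS := (andP ax).1.
  have [/aS-> // | /(propagate_diff B12 xS)[y [xy yx yS]]] := boolP (active x).
  by have := act_lt ax yS xy; rewrite ltNge ltW.
have partI k : k < #|I| -> exists c, [/\ c \in I, rank_in I c = k,
    is_min c (propagate (B k.+1) :\: propagate (B k))
    & forall x, act r (propagate (B k.+1) :\: propagate (B k)) x -> x = c].
  move=> /rank_in_surj[c cI ck]; have ac := actI c cI.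
  have [|x|? ?] := partP _ _ c (subB k) ac; last by exists c.
    by rewrite in_setD !memB // (IT _ cI) /= ck ltnn ltnSn.
  move=> ax; rewrite in_setD !memB // negb_imply => /andP[/andP[xT]].
  have xI : x \in I by rewrite actII.
  rewrite xT /= -leqNgt ltnS => x1 x2; apply: (rank_in_inj xI cI); rewrite ck.
  by apply/eqP; rewrite eqn_leq x1 x2.
have partJ k : k < #|J| -> exists c, [/\ c \in J, rank_in J c = k,
    is_min c (propagate (B' k) :\: propagate (B' k.+1))
    & forall x, act r (propagate (B' k) :\: propagate (B' k.+1)) x -> x = c].
  move=> /rank_in_surj[c cJ ck]; have ac := actJ c cJ.
  have [|x|? ?] := partP _ _ c (subB' k) ac; last by exists c.
    by rewrite in_setD [c \in B' k.+1]inE [c \in B' k]inE cJ ck ltnn leqnn.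
  move=> ax; rewrite in_setD [x \in B' k.+1]inE [x \in B' k]inE.
  case xJ: (x \in J) => //=; rewrite -ltnNge ltnS => xk; apply: (rank_in_inj xJ cJ).
  by apply/eqP; rewrite ck eqn_leq.
split.
- split; split.
  + suff -> : [set e in J | #|J| <= rank_in J e] = set0 by apply: propagate0.
    apply/setP=> x; rewrite [LHS]in_set [RHS]in_set.
    by apply/negbTE/negP=> /andP[xJ]; rewrite leqNgt rank_in_card.
  + congr propagate; apply/setP=> x; rewrite /B in_setU [x \in [set _ | _]]inE.
    by rewrite [x \in [set b in I | _]]inE andbT andbF orbF.
  + apply: propagateT => x ax; rewrite memB //; apply/implyP=> xT.
    by rewrite rank_in_card // actII.
  + move=> k /partI[c [_ _ /is_minP[+ _] _]]; rewrite inE => /andP[c1 c2].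
    by apply/properP; split; [apply: propagate_mono; apply: subB k | exists c].
  + move=> k /partJ[c [_ _ /is_minP[+ _] _]]; rewrite inE => /andP[c1 c2].
    by apply/properP; split; [apply: propagate_mono; apply: subB' k | exists c].
  + move=> k l a b /andP[kl li] ma mb.
    have [c [cI ck mc _]] := partI k (ltn_trans kl li); have [c' [cI' ck' mc' _]] :=
      partI l li.
    rewrite (is_min_uniq ma mc) (is_min_uniq mb mc') ltNge le_eqVlt.
    apply/norP; split; first by apply: contraTneq kl => e; rewrite -ck -ck' e ltnn.
    by apply: contraL kl => /(rank_in_lt cI'); rewrite ck ck' -leqNgt => /ltnW.
  + move=> k l a b /andP[kl li] ma mb.
    have [c [cI ck mc _]] := partJ k (ltn_trans kl li); have [c' [cI' ck' mc' _]] :=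
      partJ l li.
    rewrite (is_min_uniq ma mc) (is_min_uniq mb mc') ltNge le_eqVlt.
    apply/norP; split; first by apply: contraTneq kl => e; rewrite -ck -ck' e ltnn.
    by apply: contraL kl => /(rank_in_lt cI'); rewrite ck ck' -leqNgt => /ltnW.
- by move=> k _; apply: propagate_stable.
- by move=> k _; apply: propagate_stable.
case=> k; first by have [c [cJ _ mc uc]] := partJ k (ltn_ord k); exists c;
  rewrite ?(negbTE (JT _ cJ)).
by have [c [cI _ mc uc]] := partI k (ltn_ord k); exists c; rewrite ?IT.
Qed.

End OrderedBipartite.

(** * Spanning trees with a single active edge *)

Section Uniactive.
Variables (d : Order.disp_t) (V : finType) (E : finOrderType d).
Implicit Types (G H : graph V E) (T A : {set E}) (r : rel E) (X Y : {set V}).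

(** Trees of activities (1,0) or (0,1), through the coercion of booleans to
    numbers. *)
Definition uniactive_trees (internal : bool) H : {set {set E}} :=
  [set T | [&& spanning_tree H T, internal_activity H T == internal
             & external_activity H T == ~~ internal]].

Lemma min_act r A m : (forall x, ~~ r x x) -> is_min m A -> act r A m.
Proof.
move=> irr /is_minP[mA minm]; rewrite /act mA; apply/forall_inP=> y yA.
by apply/implyP=> my; rewrite lt_neqAle minm // andbT; apply: contraTneq my => <-.
Qed.

Lemma fund_adj_irr G T x : ~~ fund_adj G T x x.
Proof. by apply/negP=> /fund_adj_bip; case: (x \in T). Qed.

Lemma uniactive_treesP i H T : edges H != set0 ->
  reflect (spanning_tree H T /\ uniactive T (fund_adj H T) i (edges H)) (T \in uniactive_trees i H).
Proof.
move=> H0.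
suff eqv : T \in uniactive_trees i H <->
    spanning_tree H T /\ uniactive T (fund_adj H T) i (edges H).
  by apply: (iffP idP) => /eqv.
have [m mm] := ex_is_min H0; rewrite inE.
have [tT | nT] /= := boolP (spanning_tree H T); last by split=> [|[]].
rewrite internal_activityE // external_activityE //.
have am := min_act (@fund_adj_irr H T) mm.
set S := [set x | act (fund_adj H T) (edges H) x].
have -> : [set x in T | act (fund_adj H T) (edges H) x] = S :&: T.
  by apply/setP=> x; rewrite !inE andbC.
have -> : [set x in edges H :\: T | act (fund_adj H T) (edges H) x] = S :\: T.
  apply/setP=> x; rewrite !inE; case ax: (act _ _ x); rewrite ?andbF // !andbT.
  by rewrite (andP ax).1 andbT.
have mS : m \in S by rewrite inE.
split=> [/andP[/eqP cI /eqP cE] | [_ [m' mm' [m'T um']]]].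
  have /eqP/cards1P[s defS] : #|S| = 1 by rewrite -(cardsID T S) cI cE; case: (i).
  split=> //; exists m => //; split; last first.
    by move=> x ax; have : x \in S by [rewrite inE]; move: mS; rewrite defS !inE =>
      /eqP-> /eqP.
  move: mS cI; rewrite defS inE => /eqP <-; case: (i) =>
    [/eqP/cards1P[t eT] | /cards0_eq/setP/(_ m)].
    by have /setP/(_ t) := eT; rewrite !inE eqxx => /andP[/eqP<- ->].
  by rewrite !inE eqxx.
have defS : S = [set m].
  apply/eqP; rewrite eqEsubset sub1set mS andbT; apply/subsetP=> x; rewrite !inE => /um'->.
  by apply/eqP; apply: is_min_uniq mm' mm.
rewrite defS -m'T (is_min_uniq mm' mm).
have [mT | mT] := boolP (m \in T).
  rewrite (setIidPl _) ?sub1set // cards1 (_ : _ :\: _ = set0) ?cards0 //.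
  by apply/eqP; rewrite setD_eq0 sub1set.
by rewrite (setDidPl _) ?disjoints1 // cards1 (_ : _ :&: _ = set0) ?cards0 //;
  apply/eqP; rewrite setI_eq0 disjoints1.
Qed.

(** Exchanging c for e creates no active edge above both.  The witness of
    nonactivity of x is either kept or replaced by whichever of c and e is
    adjacent to x in the new tree. *)
Lemma swap_nonactive H T c e x (T' := e |: (T :\ c)) : spanning_tree H T ->
  c \in T -> e \notin T -> ~~ spans H (T :\ c) e -> c \in edges H -> e \in edges H ->
  x \in edges H -> (c < x)%O -> (e < x)%O ->
  ~~ act (fund_adj H T) (edges H) x -> ~~ act (fund_adj H T') (edges H) x.
Proof.
move=> tT cT eT nce cH eH xH cx ex nx.
have /spanning_treeP[TH indT spT] := tT.
have tT' : spanning_tree H T' by apply: tree_exchange.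
have /spanning_treeP[_ indT' spT'] := tT'.
have ec : e != c by apply: contraNneq eT => ->.
have [xc xe] : x != c /\ x != e by rewrite !gt_eqF.
have T'e : T' :\ e = T :\ c by rewrite setU1K // !inE negb_and eT orbT.
have eT' : e \in T' by rewrite setU11.
have cT' : c \notin T' by rewrite !inE eqxx orbF eq_sym.
have [y [yH xy yx]] : exists y, [/\ y \in edges H, fund_adj H T x y & (y < x)%O].
  by apply: not_act_lt nx => //; apply: fund_adj_bip.
suff [z [zH xz zx]] : exists z, [/\ z \in edges H, fund_adj H T' x z & (z < x)%O].
  by apply/negP=> ax; have := act_lt ax zH xz; rewrite ltNge ltW.
case/and3P: xy => _ _ /orP[] /and3P[].
  move=> xT yT nxy; have xT' : x \in T' by rewrite !inE xc xT orbT.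
  have [sc | nsc] := boolP (spans H (T' :\ x) c); last first.
    by exists c; rewrite /fund_adj xH cH xT' cT' nsc.
  have nTxc : ~~ spans H (T :\ x :\ c) c.
    by apply: contra (indT c cT); apply: spansS; apply: setSD; apply: subsetDl.
  have T'x : T' :\ x = e |: (T :\ x :\ c).
    apply/setP=> z; rewrite !inE; case: (eqVneq z e) => [-> | _] /=;
      first by rewrite eq_sym xe.
    by rewrite andbCA.
  have sxe : spans H (T :\ x) e.
    have := sc; rewrite T'x => /spans_exchange/(_ nTxc); rewrite setD1K //.
    by rewrite !inE eq_sym xc.
  have ye : y != e by apply: contraNneq nxy => ->.
  exists y; split=> //; rewrite /fund_adj xH yH xT' /= orbC /= inE negb_or !inE ye negb_and (negbTE yT) orbT.
  rewrite andbF /=; apply: contra nxy; apply: spans_trans => z; rewrite T'x =>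
    /setU1P[-> // | ].
  by rewrite !inE => /and3P[_ zx zT]; apply: spans_mem; rewrite !inE zx.
move=> yT xT nyx; have xT' : x \notin T' by rewrite !inE negb_or xe negb_and (negbTE xT) orbT.
have [sc | nsc] := boolP (spans H (T :\ c) x); last first.
  by exists e; rewrite /fund_adj xH eH xT' eT' T'e nsc orbT.
have yc : y != c by apply: contraNneq nyx => ->.
have ye : y != e by apply: contraTneq yT => ->.
have yT' : y \in T' by rewrite !inE yc yT orbT.
exists y; split=> //; rewrite /fund_adj xH yH yT' xT' orbC /=; apply/orP; left.
apply: contra nyx => s; have := spansD2 indT' yT' eT' ye s.
rewrite T'e => /(_ sc); apply: spansS; apply/subsetP=> z.
by rewrite !inE => /and3P[ze -> /orP[ze' | /andP[_ ->]]] //; rewrite ze' in ze.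
Qed.

(** Let p < q be the two smallest edges.  In a tree whose only active edge is
    p, the edge q is nonactive, hence adjacent to p, its only smaller edge: so
    exactly one of them is in the tree and they can be exchanged.  The exchange
    is injective, and applying the inequality to both values of i gives
    equality. *)
Lemma uniactive_swap i H : 1 < #|edges H| ->
  #|uniactive_trees i H| <= #|uniactive_trees (~~ i) H|.
Proof.
move=> cardH; have H0 : edges H != set0 by rewrite -card_gt0 ltnW.
have [p mp] := ex_is_min H0; have /is_minP[pH minp] := mp.
have [q mq] : exists q, is_min q (edges H :\ p).
  apply: ex_is_min; rewrite -card_gt0.
  by move: cardH; rewrite (cardsD1 p) pH.
have /is_minP[/setD1P[qp qH] minq] := mq.
have pq : (p < q)%O by rewrite lt_neqAle eq_sym qp minp.
have q_lt x : x \in edges H -> x != p -> x != q -> (q < x)%O.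
  by move=> xH xp xq; rewrite lt_neqAle eq_sym xq minq // !inE xp.
(* c is the one of p and q that is in the tree, e the other. *)
pose c := if i then p else q; pose e := if i then q else p.
have ec : e != c by rewrite /c /e; case: (i); rewrite // eq_sym.
pose sw T := e |: (T :\ c).
have uni T : T \in uniactive_trees i H ->
    [/\ spanning_tree H T, c \in T, e \notin T, ~~ spans H (T :\ c) e
      & forall x, x \in edges H -> x != p -> ~~ act (fund_adj H T) (edges H) x].
  case/(uniactive_treesP _ _ H0)=> tT [m mm [mT um]].
  have em : m = p by apply: is_min_uniq mm mp.
  rewrite em in mT um.
  have nact x : x \in edges H -> x != p -> ~~ act (fund_adj H T) (edges H) x.
    by move=> xH; apply: contra => /um->.
  have /(not_act_lt (@fund_adj_bip _ _ H T) qH)[y [yH qy yq]] := nact q qH qp.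
  have {y yH yq qy} nqp : fund_adj H T q p.
    have [<- // | yp] := eqVneq y p.
    by have := minq y; rewrite !inE yp yH leNgt yq => /(_ isT).
  have := fund_adj_bip nqp; rewrite mT => qT.
  have nce : fund_adj H T c e by rewrite /c /e; case: (i) => //; rewrite fund_adj_sym.
  have cT : c \in T by rewrite /c; case: (i) mT qT.
  have := fund_adj_bip nce; rewrite cT => /esym eT; split=> //.
  by case/and3P: nce => _ _; rewrite cT eT (negbTE eT) orbF.
have cH : c \in edges H by rewrite /c; case: ifP.
have eH : e \in edges H by rewrite /e; case: ifP.
have swK T : T \in uniactive_trees i H -> c |: (sw T :\ e) = T.
  by case/uni=> _ cT eT _ _; rewrite setU1K ?setD1K // !inE negb_and eT orbT.
rewrite -(card_in_imset (f := sw) (D := [in uniactive_trees i H])); last first.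
  by move=> T1 T2 /swK{2}<- /swK{2}<- ->.
apply/subset_leq_card/subsetP=> _ /imsetP[T /uni[tT cT eT nce nact] ->].
have tT' := tree_exchange tT cT eH nce.
have eT' : e \in sw T by rewrite setU11.
have cT' : c \notin sw T by rewrite !inE eqxx orbF eq_sym.
apply/uniactive_treesP => //; split=> //; exists p => //; split.
  by move: eT' cT'; rewrite /c /e; case: (i) => // _ /negbTE.
have /spanning_treeP[_ indT' _] := tT'; have /spanning_treeP[_ indT _] := tT.
have fund_adj' : fund_adj H (sw T) p q.
  have : fund_adj H (sw T) e c.
    rewrite /fund_adj eH cH eT' cT' /= setU1K ?indT // !inE negb_and eT orbT.
    by [].
  by rewrite /c /e; case: (i) => //; rewrite fund_adj_sym.
move=> x ax; have xH := (andP ax).1; have [// | xp] := eqVneq x p.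
have [xq | xq] := eqVneq x q.
  by have := act_lt ax pH; rewrite xq fund_adj_sym fund_adj' => /(_ isT); rewrite ltNge ltW.
have qx := q_lt x xH xp xq; have px := lt_trans pq qx.
have cx : (c < x)%O by rewrite /c; case: (i).
have ex : (e < x)%O by rewrite /e; case: (i).
by have := swap_nonactive tT cT eT nce cH eH xH cx ex (nact x xH xp); rewrite ax.
Qed.

Lemma betaE H : beta H = #|uniactive_trees true H|.
Proof. by []. Qed.

Lemma connect_set0 G x y : connect (adj G set0) x y = (x == y).
Proof.
apply/idP/eqP=> [/connectP[[|z p] /= ] | ->]; [by [] | | exact: connect0].
by case/andP=> /existsP[f]; rewrite inE.
Qed.

(** For two edges or more this is the symmetry between activities (1,0) and
    (0,1); for one edge, the tree has external activity 1 exactly for a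
    loop. *)
Lemma beta_starE H : edges H != set0 -> beta_star H = #|uniactive_trees false H|.
Proof.
move=> H0; rewrite /beta_star; case: ltnP => [c1 | c1].
  by apply/eqP; rewrite eqn_leq betaE (@uniactive_swap true) // (@uniactive_swap false).
have /cards1P[e eH] : #|edges H| == 1 by rewrite eqn_leq c1 card_gt0.
have -> : single_loop H = is_loop H e.
  apply/existsP/idP => [[e' /andP[]] | le]; last by exists e; rewrite eH eqxx.
  by rewrite eH => /eqP/set1_inj->.
have me : is_min e (edges H).
  by apply/is_minP; rewrite eH inE; split=> // f; rewrite inE => /eqP->.
have tr0 : spanning_tree H set0 = is_loop H e.
  rewrite /is_loop -(connect_set0 H); apply/spanning_treeP/idP => [[_ _] | le].
    by apply; rewrite eH inE.
  by split=> [|f|f]; rewrite ?sub0set ?inE // eH inE => /eqP->.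
have -> : uniactive_trees false H = if is_loop H e then [set set0] else set0.
  apply/setP=> T; apply/uniactive_treesP/idP => // [[tT [m mm [mT _]]] | ].
    have T0 : T = set0.
      apply/eqP; rewrite -subset0; apply/subsetP=> f fT; have /spanning_treeP[TH _ _] := tT.
      by have := subsetP TH f fT; rewrite eH inE => /eqP fe;
        rewrite (is_min_uniq mm me) -fe fT in mT.
    by rewrite -tr0 -T0 tT inE.
  case: ifP => le; rewrite inE // => /eqP->; rewrite tr0 le; split=> //.
  exists e => //; split=> [|x /andP[+ _]]; rewrite ?inE //.
  by rewrite eH inE => /eqP.
by case: is_loop; rewrite ?cards1 ?cards0.
Qed.

(** The minima of both sides would be active. *)
Lemma uniactive_separation i H T A : A \subset edges H -> A != set0 ->
  edges H :\: A != set0 ->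
  (forall x y, x \in A -> y \in edges H :\: A -> ~~ fund_adj H T x y) ->
    ~ uniactive T (fund_adj H T) i (edges H).
Proof.
move=> AH /ex_is_min[a ma] /ex_is_min[b mb] sep [m _ [_ um]].
have /is_minP[aA _] := ma; have /is_minP[bB _] := mb.
have ea : a = m.
  apply: um; apply/andP; split; first exact: (subsetP AH).
  apply/forall_inP=> y yH; apply/implyP=> ay.
  apply: (act_lt (min_act (@fund_adj_irr H T) ma) _ ay); apply: contraT => yA.
  by have := sep a y aA; rewrite inE yA yH ay => /(_ isT).
have eb : b = m.
  apply: um; apply/andP; split; first by case/setDP: bB.
  apply/forall_inP=> y yH; apply/implyP=> by_.
  apply: (act_lt (min_act (@fund_adj_irr H T) mb) _ by_); rewrite inE yH andbT.
  by apply: contraL by_ => yA; rewrite fund_adj_sym sep.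
by move: bB; rewrite eb -ea inE aA.
Qed.

(** Used with the maps that collapse one side of a cut vertex to that
    vertex. *)
Lemma connect_map G (F F' : {set E}) (rho : V -> V) u v :
  (forall f, f \in F -> connect (adj G F') (rho (ends G f).1) (rho (ends G f).2)) ->
  connect (adj G F) u v -> connect (adj G F') (rho u) (rho v).
Proof.
move=> h /connectP[p]; elim: p u => [u _ -> | w p IHp u /= /andP[uw /IHp{}IHp] /IHp{IHp}].
  exact: connect0.
apply: connect_trans; case/existsP: uw => f /andP[/h + /orP[]/eqP ef]; rewrite ef //=.
by rewrite adj_sym.
Qed.

(** X is a union of components of H minus w.  Collapsing X, or its complement,
    to w shows that an edge on one side is spanned by tree edges of that side,
    so there are no adjacencies between the two sides.  The case where w has
    no edge to X covers disconnected graphs. *)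
Lemma uniactive_cutvertex i H T X w : spanning_tree H T -> w \notin X ->
  (forall f, f \in edges H -> ((ends H f).1 \in X) || ((ends H f).2 \in X) ->
     ((ends H f).1 \in w |: X) && ((ends H f).2 \in w |: X)) ->
  (exists2 f, f \in edges H & ((ends H f).1 \in X) || ((ends H f).2 \in X)) ->
  (exists2 f, f \in edges H & ~~ (((ends H f).1 \in X) || ((ends H f).2 \in X))) ->
  ~ uniactive T (fund_adj H T) i (edges H).
Proof.
move=> /spanning_treeP[TH indT spT] wX hX [f fH fX] [g gH gX].
pose A := [set f in edges H | ((ends H f).1 \in X) || ((ends H f).2 \in X)].
have spA e : e \in A -> spans H (T :&: A) e.
  (* rho collapses the complement of X to w. *)
  rewrite inE => /andP[eH eX]; pose rho u := if u \in X then u else w.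
  have fixw u : u \in w |: X -> rho u = u.
    by rewrite /rho => /setU1P[-> | ->] //; rewrite (negbTE wX).
  have /andP[e1 e2] := hX e eH eX.
  rewrite /spans -[(ends H e).1]fixw // -[(ends H e).2]fixw //.
  apply: connect_map (spT e eH) => h hT; have hH := subsetP TH h hT.
  have [hA | hA] := boolP (((ends H h).1 \in X) || ((ends H h).2 \in X)).
    have /andP[h1 h2] := hX h hH hA; rewrite !fixw //.
    by apply: spans_mem; rewrite !inE hT hH.
  by move: hA; rewrite /rho negb_or => /andP[/negbTE-> /negbTE->].
have spB e : e \in edges H :\: A -> spans H (T :\: A) e.
  rewrite !inE => /andP[+ eH]; rewrite eH /= negb_or => /andP[e1 e2].
  (* rho collapses X to w. *)
  pose rho u := if u \in X then w else u.
  have fixX u : u \notin X -> rho u = u by rewrite /rho => /negbTE->.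
  rewrite /spans -[(ends H e).1]fixX // -[(ends H e).2]fixX //.
  apply: connect_map (spT e eH) => h hT; have hH := subsetP TH h hT.
  have [hA | hA] := boolP (((ends H h).1 \in X) || ((ends H h).2 \in X)).
    have mapw u : u \in w |: X -> rho u = w.
      by rewrite /rho => /setU1P[-> | ->] //; case: ifP.
    by have /andP[h1 h2] := hX h hH hA; rewrite !mapw.
  move: (hA); rewrite negb_or => /andP[h1 h2]; rewrite !fixX //.
  by apply: spans_mem; rewrite !inE hT hH andbT.
apply: (@uniactive_separation _ _ _ A).
- by apply/subsetP=> e; rewrite inE => /andP[].
- by apply/set0Pn; exists f; rewrite inE fH.
- by apply/set0Pn; exists g; rewrite !inE gH andbT.
move=> x y xA yB; have yA : y \notin A by case/setDP: yB.
apply/negP=> /and3P[xH yH /orP[]/and3P[xT yT]].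
  case/negP; apply: spansS (spB y yB); rewrite subsetD1 subsetDl !inE.
  by move: xA; rewrite inE => ->.
case/negP; apply: spansS (spA x xA); rewrite subsetD1 subsetIl !inE.
by move: yA; rewrite inE => /negbTE->; rewrite andbF.
Qed.

Lemma vset_end H f : f \in edges H -> ((ends H f).1 \in vset H) && ((ends H f).2 \in vset H).
Proof.
by move=> fH; rewrite !inE; apply/andP; split; apply/exists_inP; exists f;
  rewrite ?eqxx ?orbT.
Qed.

Lemma uniactive_connected_on i H T Y : spanning_tree H T ->
  uniactive T (fund_adj H T) i (edges H) ->
  Y = vset H \/ (exists w, Y = vset H :\ w) -> connected_on H Y.
Proof.
move=> tT uT hY; apply/forall_inP=> u uY; apply/forall_inP=> v vY; apply: contraT => nuv.
set R := (fun x y => _) in nuv; pose X := [set x in Y | connect R u x].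
have YH : Y \subset vset H by case: hY => [-> | [w ->]]; rewrite ?subsetDl.
have [w wX YHw] : exists2 w, w \notin X & vset H \subset w |: Y.
  case: hY => [<- | [w eY]]; first by exists v; rewrite ?inE ?(negbTE nuv) ?andbF ?subsetUr.
  exists w; first by rewrite inE eY !inE eqxx.
  by apply/subsetP=> z zH; rewrite eY in_setU1 in_setD1 zH andbT orbN.
have growX x y : x \in X -> adj H (edges H) x y -> y \in Y -> y \in X.
  rewrite !inE => /andP[xY ux] xy yY; rewrite yY; apply: connect_trans ux _.
  by apply: connect1; rewrite /R xY yY.
have adj_step f : f \in edges H -> ((ends H f).1 \in X -> (ends H f).2 \in Y ->
  (ends H f).2 \in X) /\
     ((ends H f).2 \in X -> (ends H f).1 \in Y -> (ends H f).1 \in X).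
  move=> fH; split=> fX; apply: growX fX _; first exact: adj_end.
  by apply/existsP; exists f; rewrite fH -surjective_pairing eqxx orbT.
have XY x : x \in X -> x \in Y by rewrite inE => /andP[].
have edge_at x : x \in Y -> exists2 f, f \in edges H & (x == (ends H f).1) ||
  (x == (ends H f).2).
  by move=> /(subsetP YH); rewrite inE => /exists_inP.
exfalso; move: uT; apply: (@uniactive_cutvertex _ _ _ X w) => //.
- move=> f fH fX; have /andP[/(subsetP YHw) f1 /(subsetP YHw) f2] := vset_end fH.
  have [h1 h2] := adj_step f fH.
  case/orP: fX => fX; rewrite !in_setU1 fX orbT ?andbT /=.
    by case/setU1P: f2 => [-> | /(h1 fX)->]; rewrite ?eqxx ?orbT.
  by case/setU1P: f1 => [-> | /(h2 fX)->]; rewrite ?eqxx ?orbT.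
- have [f fH fu] := edge_at u uY; exists f => //.
  have uX : u \in X by rewrite inE uY connect0.
  by case/orP: fu => /eqP<-; rewrite uX ?orbT.
have [f fH fv] := edge_at v vY; exists f => //; have [h1 h2] := adj_step f fH.
have vX : v \notin X by rewrite inE (negbTE nuv) andbF.
rewrite negb_or; case/orP: fv => /eqP ev; rewrite -ev in h1 h2 *; rewrite vX ?andbT /=.
  by apply: contra vX => /h2; apply.
by apply: contra vX => /h1; apply.
Qed.

Lemma uniactive_big_block i H T : 1 < #|edges H| -> T \in uniactive_trees i H ->
  big_block H.
Proof.
move=> cardH; have H0 : edges H != set0 by rewrite -card_gt0 ltnW.
case/(uniactive_treesP _ _ H0)=> tT uT; have /spanning_treeP[TH indT spT] := tT.
have loopH : loopless H.
  apply/forall_inP=> e eH; apply/negP=> /eqP le.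
  have sp F : spans H F e by rewrite /spans le.
  apply: (@uniactive_separation _ _ _ [set e] _ _ _ _ uT).
  - by rewrite sub1set.
  - by apply/set0Pn; exists e; rewrite inE.
  - by rewrite -card_gt0; rewrite (cardsD1 e) eH in cardH.
  move=> x y; rewrite inE => /eqP-> _; apply/negP=> /and3P[_ _ /orP[]/and3P[]].
    by move/indT; rewrite sp.
  by rewrite sp.
rewrite /big_block loopH cardH /two_connected !andbT /=; apply/and3P; split.
- have /set0Pn[e eH] := H0; have /andP[e1 e2] := vset_end eH.
  apply/card_gt1P; exists (ends H e).1, (ends H e).2; split=> //.
  exact: (forall_inP loopH).
- by apply: uniactive_connected_on tT uT _; left.
by apply/forall_inP=> w _; apply: uniactive_connected_on tT uT _; right; exists w.
Qed.

Lemma beta_neq0 H : edges H != set0 -> beta H != 0 -> big_block H || single_isthmus H.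
Proof.
move=> H0; rewrite betaE -lt0n card_gt0 => /set0Pn[T uT].
have [c1 | c1] := ltnP 1 #|edges H|; first by rewrite (uniactive_big_block c1 uT).
apply/orP; right; have /cards1P[e eH] : #|edges H| == 1 by rewrite eqn_leq c1 card_gt0.
apply/existsP; exists e; rewrite eH eqxx /isthmus eH inE eqxx /=.
have /(uniactive_treesP _ _ H0)[tT [m /is_minP[mH _] [mT _]]] := uT.
have {mH} me : m = e by move: mH; rewrite eH inE => /eqP.
have /spanning_treeP[_ indT _] := tT; rewrite me in mT.
by have := indT e mT; apply: contra; apply: spansS; rewrite setDv sub0set.
Qed.

Lemma beta_star_neq0 H : edges H != set0 -> beta_star H != 0 -> big_block H ||
  single_loop H.
Proof.
move=> H0; have [c1 | c1] := ltnP 1 #|edges H|.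
  rewrite beta_starE // -lt0n card_gt0 => /set0Pn[T uT].
  by rewrite (uniactive_big_block c1 uT).
by rewrite /beta_star ltnNge c1 /=; case: single_loop; rewrite ?orbT.
Qed.

End Uniactive.

(** A set is given by its traces on the blocks of a partition, which can be
    chosen independently. *)
Lemma card_parts (I E : finType) (X : {set E}) (A : I -> {set E}) (Q : I -> {set {set E}}) :
  X = \bigcup_p A p -> (forall p q x, x \in A p -> x \in A q -> p = q) ->
  (forall p t, t \in Q p -> t \subset A p) ->
  #|[set T : {set E} | (T \subset X) && [forall p, T :&: A p \in Q p]]| = \prod_p #|Q p|.
Proof.
move=> defX disA QA; pose U (f : {ffun I -> {set E}}) := \bigcup_p f p.
have UA f p : f \in family Q -> U f :&: A p = f p.
  move=> /familyP fQ; apply/setP=> x; rewrite inE; apply/andP/idP =>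
    [[/bigcupP[q _ xq] xp] | xp].
    by rewrite (disA p q x xp (subsetP (QA q _ (fQ q)) x xq)).
  by split; [apply/bigcupP; exists p | apply: subsetP xp; apply: QA].
have -> : [set T : {set E} | (T \subset X) && [forall p,
  T :&: A p \in Q p]] = U @: [set f in family Q].
  apply/setP=> T; rewrite inE; apply/andP/imsetP => [[TX /forallP TQ] | [f]].
    exists [ffun p => T :&: A p]; first by rewrite inE; apply/familyP=> p; rewrite ffunE.
    apply/setP=> x; apply/idP/bigcupP => [xT | [p _]]; last by rewrite ffunE inE => /andP[].
    have := subsetP TX x xT; rewrite defX => /bigcupP[p _ xp].
    by exists p; rewrite // ffunE inE xT.
  rewrite inE => fQ ->; split; last by apply/forallP=> p; rewrite UA //;
    have /familyP := fQ; apply.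
  rewrite defX; apply/bigcupsP=> p _; apply/subsetP=> x xp; apply/bigcupP; exists p => //.
  by apply: subsetP xp; apply: QA; have /familyP := fQ; apply.
rewrite card_in_imset; last first.
  by move=> f g; rewrite !inE => fQ gQ fg; apply/ffunP=> p; rewrite -UA // fg UA.
rewrite cardsE card_family foldrE big_image /=.
by apply: eq_bigr.
Qed.

(** * Spanning trees decomposed by a filtration *)

Section Filtrations.
Variables (d : Order.disp_t) (V : finType) (E : finOrderType d) (G : graph V E).
Implicit Types (T A : {set E}).

Lemma is_filtrationP j i (F' : j.+1.-tuple {set E}) Fc (F : i.+1.-tuple {set E}) :
  is_filtration G F' Fc F <->
  Fc = nth set0 F 0 /\ filtered (edges G) (nth set0 F') (nth set0 F) j i.
Proof.
rewrite /is_filtration !size_tuple /=; split.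
  case/and5P=> /eqP F'j /eqP F'0 /eqP F0 /eqP Fi /and4P[/forallP up /forallP dn mi mj].
  split=> //; split; first by split=> //; rewrite F'0.
  split.
  - by move=> k ki; apply: (up (Ordinal ki)).
  - by move=> k kj; apply: (dn (Ordinal kj)).
  - move=> k l a b /andP[kl li] ma mb; have ki := ltn_trans kl li.
    have /forallP/(_ (Ordinal ki))/forallP/(_ (Ordinal li))/implyP/(_ kl) := mi.
    case/existsP=> a' /existsP[b' /and3P[ma' mb' ab]].
    by rewrite (is_min_uniq ma ma') (is_min_uniq mb mb').
  move=> k l a b /andP[kl lj] ma mb; have kj := ltn_trans kl lj.
  have /forallP/(_ (Ordinal kj))/forallP/(_ (Ordinal lj))/implyP/(_ kl) := mj.
  case/existsP=> a' /existsP[b' /and3P[ma' mb' ab]].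
  by rewrite (is_min_uniq ma ma') (is_min_uniq mb mb').
move=> [-> filtF]; have [[F'j F'0 Fi] [up dn mi mj]] := filtF.
rewrite F'j F'0 Fi !eqxx /=; apply/and4P; split.
- by apply/forallP=> k; apply: up.
- by apply/forallP=> k; apply: dn.
- apply/forallP=> k; apply/forallP=> l; apply/implyP=> kl.
  have [a ma] := ex_is_min (part_neq0 filtF (inr k)).
  have [b mb] := ex_is_min (part_neq0 filtF (inr l)).
  apply/existsP; exists a; apply/existsP; exists b; apply/and3P; split=> //.
  by apply: (mi k l); rewrite ?kl ?ltn_ord.
apply/forallP=> k; apply/forallP=> l; apply/implyP=> kl.
have [a ma] := ex_is_min (part_neq0 filtF (inl k)).
have [b mb] := ex_is_min (part_neq0 filtF (inl l)).
apply/existsP; exists a; apply/existsP; exists b; apply/and3P; split=> //.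
by apply: (mj k l); rewrite ?kl ?ltn_ord.
Qed.

Definition part_minor j i (F' F : nat -> {set E}) (p : 'I_j + 'I_i) := match p with
  | inl k => minor G (F' k) (F' k.+1) | inr k => minor G (F k.+1) (F k) end.

Definition decomposes j i (F' F : nat -> {set E}) T :=
  (T \subset edges G) && [forall p : 'I_j + 'I_i,
     T :&: part F' F p \in uniactive_trees (internal p) (part_minor F' F p)].

Definition weight j i (F' F : nat -> {set E}) :=
  (\prod_(k < i) beta (minor G (F k.+1) (F k))) *
  (\prod_(k < j) beta_star (minor G (F' k) (F' k.+1))).

Section OneFiltration.
Variables (j i : nat) (F' F : nat -> {set E}).
Hypothesis filtF : filtered (edges G) F' F j i.

Lemma edges_part_minor (p : 'I_j + 'I_i) : edges (part_minor F' F p) = part F' F p.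
Proof.
case: p => k; apply: edges_minor; first exact: (filtered_subX' filtF (ltnW (ltn_ord k))).
exact: (filtered_subX filtF (ltn_ord k)).
Qed.

Lemma card_decomposes : #|[set T | decomposes j i F' F T]| =
  weight j i F' F.
Proof.
rewrite /weight (@card_parts _ _ _ (@part _ _ F' F j i)
  (fun p => uniactive_trees (internal p) (part_minor F' F p))).
- rewrite big_sumType mulnC /=; congr (_ * _); apply: eq_bigr => k _.
  rewrite beta_starE //; have := edges_part_minor (inl k); rewrite /part_minor => ->.
  exact: (part_neq0 filtF (inl k)).
- apply/setP=> x; apply/idP/bigcupP=> [/(part_cover filtF)[p xp] | [p _]];
  first by exists p.
  exact: (subsetP (part_subX filtF p)).
- by move=> p q x; apply: part_inj filtF _ _ _.
move=> p T; rewrite inE => /and3P[/spanning_treeP[+ _ _] _ _].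
by rewrite edges_part_minor.
Qed.

Lemma act_eq (r r' : rel E) A x : {in A &, r =2 r'} -> act r A x = act r' A x.
Proof.
move=> rr'; rewrite /act; case xA: (x \in A) => //=.
by apply: eq_forallb => y; case yA: (y \in A); rewrite //= rr'.
Qed.

Lemma uniactive_minor (b : bool) (F1 F2 T : {set E}) : F1 \proper F2 ->
  F2 \subset edges G ->
  spanning_tree G T -> basis G F1 (T :&: F1) -> basis G F2 (T :&: F2) ->
  T :&: (F2 :\: F1) \in uniactive_trees b (minor G F2 F1) <->
  uniactive T (fund_adj G T) b (F2 :\: F1).
Proof.
move=> prF F2G tT b1 b2; have F12 := proper_sub prF; set A := F2 :\: F1.
have A0 : A != set0 by rewrite setD_eq0; case/properP: prF => _ [x xF2];
  apply: contra => /subsetP; apply.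
have tA := minor_basis F12 F2G b1 b2.
have actA x : act (fund_adj (minor G F2 F1) (T :&: A)) A x = act (fund_adj G T) A x.
  by apply: act_eq; apply: fund_adj_minor.
have eA : edges (minor G F2 F1) = A by apply: edges_minor.
have uA : uniactive (T :&: A) (fund_adj (minor G F2 F1) (T :&: A)) b A <-> uniactive T (fund_adj G T) b A.
  split=> -[m mm [mT um]]; have /is_minP[mA _] := mm; exists m => //.
    by split=> [|x ax]; [rewrite inE mA andbT in mT | apply: um; rewrite actA].
  by split=> [|x]; [rewrite inE mA andbT | rewrite actA; apply: um].
split=> [/uniactive_treesP | h]; first by rewrite eA => /(_ A0)[_ /uA].
by apply/uniactive_treesP; rewrite eA // ; split=> //; apply/uA.
Qed.

(** From left to right, the trees of the minors are glued one after the other,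
    up the lower chain and then up the upper one. *)
Lemma decomposesP T : decomposes j i F' F T <->
  spanning_tree G T /\ decomposition (edges G) T (fund_adj G T) F' F j i.
Proof.
have [[F'j F'0 Fi] [up dn _ _]] := filtF.
split.
  case/andP=> TG /forallP decT.
  have cat k (F1 F2 : {set E}) : F1 \subset F2 -> F2 \subset edges G ->
    basis G F1 (T :&: F1) ->
      T :&: (F2 :\: F1) \in uniactive_trees k (minor G F2 F1) -> basis G F2 (T :&: F2).
    move=> F12 F2G b1; rewrite inE => /and3P[t2 _ _].
    have := basis_minor F12 F2G b1 t2; rewrite -setIUr.
    by rewrite -{1}(setIidPr F12) setID.
  have bF'_aux n : n <= j -> basis G (F' (j - n)) (T :&: F' (j - n)).
    elim: n => [_ | n IHn nj]; first by rewrite subn0 F'j setI0; apply: basis0.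
    have kj : j - n.+1 < j by rewrite subnSK // leq_subr.
    apply: (cat false (F' (j - n.+1).+1)).
    - exact/proper_sub/dn.
    - exact: filtered_subX' filtF _ (ltnW kj).
    - by rewrite subnSK //; apply: IHn; apply: ltnW.
    exact: decT (inl (Ordinal kj)).
  have bF' k : k <= j -> basis G (F' k) (T :&: F' k).
    by move=> kj; rewrite -(subKn kj); apply: bF'_aux; apply: leq_subr.
  have bF k : k <= i -> basis G (F k) (T :&: F k).
    elim: k => [_ | k IHk ki]; first by rewrite -F'0; apply: bF'.
    apply: (cat true (F k)); [exact/proper_sub/up | exact: filtered_subX filtF _ ki | |].
      by apply: IHk; apply: ltnW.
    exact: decT (inr (Ordinal ki)).
  have tT : spanning_tree G T.
    by apply/basis_tree; have := bF i (leqnn i); rewrite Fi (setIidPl TG).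
  split=> //; split=> // [k ki | k kj | p].
  - by apply/(basis_stable tT); [apply: filtered_subX filtF _ ki | apply: bF].
  - by apply/(basis_stable tT); [apply: filtered_subX' filtF _ kj | apply: bF'].
  have := decT p; case: p => k /=.
    have kj := ltn_ord k.
    by move/(uniactive_minor false (dn k kj) (filtered_subX' filtF (ltnW kj)) tT (bF' k.+1 kj) (bF' k (ltnW kj))).
  have ki := ltn_ord k.
  by move/(uniactive_minor true (up k ki) (filtered_subX filtF ki) tT (bF k (ltnW ki)) (bF k.+1 ki)).
case=> tT [_ st st' un]; have /spanning_treeP[TG _ _] := tT; rewrite /decomposes TG.
have bF k : k <= i -> basis G (F k) (T :&: F k).
  by move=> ki; apply/(basis_stable tT); [apply: filtered_subX filtF _ ki | apply: st].
have bF' k : k <= j -> basis G (F' k) (T :&: F' k).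
  by move=> kj; apply/(basis_stable tT); [apply: filtered_subX' filtF _ kj | apply: st'].
apply/forallP=> p; have := un p; case: p => k /=.
  have kj := ltn_ord k.
  by move/(uniactive_minor false (dn k kj) (filtered_subX' filtF (ltnW kj)) tT (bF' k.+1 kj) (bF' k (ltnW kj))).
have ki := ltn_ord k.
by move/(uniactive_minor true (up k ki) (filtered_subX filtF ki) tT (bF k (ltnW ki)) (bF k.+1 ki)).
Qed.

End OneFiltration.

(** The existence and uniqueness of the decomposition, as a cardinal. *)
Lemma card_decomposed_by j i T :
  #|[pred q : j.+1.-tuple {set E} * {set E} * i.+1.-tuple {set E} |
      is_filtration G q.1.1 q.1.2 q.2 && decomposes j i (nth set0 q.1.1) (nth set0 q.2) T]| =
  [&& spanning_tree G T, internal_activity G T == i & external_activity G T == j].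
Proof.
set P := [pred q | _].
have PE (F' : j.+1.-tuple {set E}) Fc (F : i.+1.-tuple {set E}) : P (F', Fc, F) <->
    Fc = nth set0 F 0 /\ spanning_tree G T /\
    decomposition (edges G) T (fund_adj G T) (nth set0 F') (nth set0 F) j i.
  rewrite /=; split=> [/andP[/is_filtrationP[-> filtF] /(decomposesP filtF)] // | [-> [tT dF]]].
  have [filtF _ _ _] := dF; apply/andP; split; first exact/is_filtrationP.
  exact/(decomposesP filtF).
have nbS := @fund_adj_sym _ _ G T; have nbB := @fund_adj_bip _ _ G T; have nbX :=
  @fund_adj_edge _ _ G T.
have [/and3P[tT /eqP cI /eqP cJ] | nT] := boolP [&& _, _ & _]; last first.
  apply: eq_card0 => -[[F' Fc] F]; apply: contraNF nT => /PE[_ [tT dF]].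
  have [cI cJ _ _] := decomposition_eq nbS nbB dF.
  by rewrite tT internal_activityE // external_activityE // cI cJ !eqxx.
have := decomposition_exists nbS nbB nbX.
rewrite -internal_activityE // -external_activityE // cI cJ.
set S' := fun k => propagate _ _ _ _; set S := fun k => propagate _ _ _ _ => decS.
pose F' := [tuple S' k | k < j.+1]; pose F := [tuple S k | k < i.+1].
have F'E k : k <= j -> nth set0 F' k = S' k.
  by move=> kj; rewrite -[k]/(nat_of_ord (Ordinal (kj : k < j.+1))) -tnth_nth tnth_mktuple.
have FE k : k <= i -> nth set0 F k = S k.
  by move=> ki; rewrite -[k]/(nat_of_ord (Ordinal (ki : k < i.+1))) -tnth_nth tnth_mktuple.
have uniq_dec F1' Fc F1 : P (F1', Fc, F1) -> (F1', Fc, F1) = (F', S 0, F).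
  case/PE=> -> [_ dF]; have [_ _ eF eF'] := decomposition_eq nbS nbB dF.
  rewrite eF //; congr (_, _, _); apply: eq_from_tnth => k; rewrite !(tnth_nth set0).
    by rewrite F'E ?eF' // -ltnS.
  by rewrite FE ?eF // -ltnS.
have PF : P (F', S 0, F).
  apply/PE; rewrite FE //; split=> //; split=> //.
  by apply: decomposition_congr decS => k kl; rewrite ?F'E ?FE.
rewrite (@eq_card1 _ (F', S 0, F)) // => -[[F1' Fc] F1]; apply/idP/eqP;
  first exact: uniq_dec.
by move=> ->.
Qed.

(** Double counting of the pairs of a spanning tree and a filtration that
    decomposes it. *)
Lemma tcoef_filtrations i j :
  tcoef G i j = \sum_(F' : j.+1.-tuple {set E}) \sum_(Fc : {set E})
    \sum_(F : i.+1.-tuple {set E} | is_filtration G F' Fc F)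
      weight j i (nth set0 F') (nth set0 F).
Proof.
pose f (q : j.+1.-tuple {set E} * {set E} * i.+1.-tuple {set E}) T : nat :=
  is_filtration G q.1.1 q.1.2 q.2 && decomposes j i (nth set0 q.1.1) (nth set0 q.2) T.
transitivity (\sum_T \sum_q f q T).
  rewrite /tcoef cardsE -sum1_card big_mkcond; apply: eq_bigr => T _.
  transitivity (nat_of_bool [&& spanning_tree G T, internal_activity G T == i
    & external_activity G T == j]); first by rewrite unfold_in; case: ifP.
  by rewrite -card_decomposed_by -sum1_card big_mkcond; apply: eq_bigr => q _; rewrite inE.
rewrite exchange_big /= -(pair_bigA _ (fun a b => \sum_T f (a, b) T)) /=.
rewrite -(pair_bigA _ (fun a b => \sum_c \sum_T f (a, b, c) T)) /=.
apply: eq_bigr => F' _; apply: eq_bigr => Fc _; rewrite [RHS]big_mkcond.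
apply: eq_bigr => F _; rewrite /f /=; case: ifP => [/is_filtrationP[_ filtF] | _];
  last by rewrite big1.
by rewrite -card_decomposes // cardsE -sum1_card [RHS]big_mkcond.
Qed.

Lemma weight_connected j i (F' : j.+1.-tuple {set E}) Fc (F : i.+1.-tuple {set E}) :
  is_filtration G F' Fc F -> weight j i (nth set0 F') (nth set0 F) != 0 ->
  is_connected_filtration G F' Fc F.
Proof.
move=> filt; have [_ filtF] := (is_filtrationP _ _ _).1 filt.
rewrite /is_connected_filtration filt !size_tuple /weight muln_eq0 negb_or /= =>
  /andP[b0 bs0].
apply/andP; split; apply/forallP=> k.
  apply: beta_neq0.
    by rewrite (edges_part_minor filtF (inr k)) (part_neq0 filtF (inr k)).
  by apply: contraNneq b0 => b0; rewrite (bigD1 k) //= b0.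
apply: beta_star_neq0.
  by rewrite (edges_part_minor filtF (inl k)) (part_neq0 filtF (inl k)).
by apply: contraNneq bs0 => b0'; rewrite (bigD1 k) //= b0'.
Qed.

End Filtrations.

(** P may be any property between being a filtration and being a filtration of
    nonzero weight; both forms of the theorem are instances. *)
Lemma filtration_sumE d V (E : finOrderType d) (G : graph V E)
    (P : seq {set E} -> {set E} -> seq {set E} -> bool) :
  (forall i j (F' : j.+1.-tuple {set E}) Fc (F : i.+1.-tuple {set E}), 
    is_filtration G F' Fc F -> weight G j i (nth set0 F') (nth set0 F) != 0 -> P F' Fc F) ->
  (forall F' Fc F, P F' Fc F -> is_filtration G F' Fc F) ->
  tutte G = filtration_sum G P.
Proof.
move=> nzP Pf; apply: eq_bigr => i _; apply: eq_bigr => j _.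
rewrite tcoef_filtrations natr_sum mulr_suml; apply: eq_bigr => F' _.
rewrite natr_sum mulr_suml; apply: eq_bigr => Fc _; rewrite natr_sum mulr_suml.
rewrite [LHS]big_mkcond [RHS]big_mkcond; apply: eq_bigr => F _.
rewrite !big_add1 /= !big_mkord -natrM -/(weight G j i (nth set0 F') (nth set0 F)).
have [filt | nfilt] := boolP (is_filtration G F' Fc F); last first.
  by case: ifP => // /Pf; rewrite (negbTE nfilt).
case: ifP => // nP; case: eqP (nzP i j F' Fc F filt) => [-> _ | _ /(_ isT)];
  first by rewrite mul0r.
by rewrite nP.
Qed.

Theorem theorem3p13 (d : Order.disp_t) (V : finType) (E : finOrderType d)
    (G : graph V E) (G_connected : connected_graph G) :
  tutte G = filtration_sum G (is_connected_filtration G) /\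
  tutte G = filtration_sum G (is_filtration G).
Proof.
split; apply: filtration_sumE => // [i j F' Fc F | F' Fc F /and3P[] //].
exact: weight_connected.
Qed.
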